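(* Writes in PaRiS are atomic. That is, in every execution of the PaRiS protocol (described in the context), for every transaction $T'$ that commits updates, every other transaction $T$, and every admissible choice of the replicas (and serving times) used for the reads of $T$, either all the versions written by $T'$ belong to the snapshot $S_T$ visible to $T$, or none of them does.
   Context: **System.** A multi-version key-value store is split into $N$ partitions; each key $k$ belongs to one partition $partition(k)$. There are $M$ data centers (DCs). Each partition is replicated at $R$ of the DCs. The server of partition $n$ in DC $m$ (if $m$ replicates $n$) is $p_n^m$; its replica index among the $R$ replicas of partition $n$ is denoted $r$. Servers communicate through lossless FIFO channels with arbitrary finite delays; each event handler executes atomically. Timestamps are nonnegative integers. An item version is $d=\langle k,v,ut,id_T,sr\rangle$: key, value, update timestamp, id of the creating transaction, id of the DC where it was created. Versions of one key are totally ordered lexicographically by $(ut,id_T,sr)$; ''freshest'' means largest in this order. **Server state.** $p_n^m$ has a physical clock $Clock_n^m$ (monotonically increasing: each reading is strictly larger than the previous ones), a hybrid logical clock $HLC_n^m$, a version vector $VV_n^m$ with $R$ entries, a scalar $ust_n^m$ (universal stable time), and sets $Prepared_n^m$, $Committed_n^m$. $HLC_n^m$, all entries of $VV_n^m$ and $ust_n^m$ are initially $0$; the sets are initially empty. **Client state.** A client $c$ issues operations sequentially. It keeps $ust_c$, $hwt_c$ (both initially $0$), a private write cache $WC_c$, and a read set $RS_c$ and write set $WS_c$ of the current transaction. **Start.** $c$ sends $ust_c$ to a coordinator server $p_n^m$ in its local DC; $p_n^m$ sets $ust_n^m\gets\max\{ust_n^m,ust_c\}$, generates a unique transaction id, and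 returns $ust_n^m$ as the snapshot timestamp $sn_T$ of the transaction $T$. Then $c$ sets $ust_c\gets sn_T$, $RS_c,WS_c\gets\emptyset$, and removes from $WC_c$ all versions with timestamp $\le ust_c$. **Read.** For each key $k$, $c$ looks in $WS_c$, then $RS_c$, then $WC_c$, and returns a version found there. Otherwise the read is forwarded by the coordinator to some replica (in any DC) of the partition of $k$; this server sets its own universal stable time to the max of itself and $sn_T$, and returns the freshest version $d$ of $k$ that it has installed with $d.ut\le sn_T$. Versions read are added to $RS_c$. **Write.** Writes are buffered in $WS_c$ (at most one entry per key). **Commit** (only if $WS_c\ne\emptyset$). $c$ sends $hwt_c$ and $WS_c$ to the coordinator, which sets $ht=\max\{sn_T,hwt_c\}$ and, for each partition with at least one written key, picks one replica (a cohort) and sends it a prepare message with $sn_T$, $ht$ and its updates. On prepare, a cohort $p_n^m$ sets $HLC_n^m\gets\max(Clock_n^m,ht+1,HLC_n^m+1)$, $ust_n^m\gets\max\{ust_n^m,sn_T\}$, proposes $pt=\max\{HLC_n^m,ust_n^m\}$, adds $(id_T,pt,\text{updates})$ to $Prepared_n^m$, and replies $pt$. The coordinator sets the commit time $T.ct$ to the maximum of the proposed times and sends it to all cohorts and to $c$. On commit, a cohort sets $HLC_n^m\gets\max(HLC_n^m,ct,Clock_n^m)$ and moves the transaction from $Prepared_n^m$ to $Committed_n^m$ with timestamp $ct$. Upon the reply, $c$ sets $hwt_c\gets ct$, tags the entries of $WS_c$ with $ct$ and moves them to $WC_c$, overwriting older entries for the same key. All versions written by $T$ have $ut=T.ct$.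 **Applying and replicating.** Periodically, $p_n^m$ computes $ub=\min\{pt : pt \text{ in } Prepared_n^m\}-1$ if $Prepared_n^m\neq\emptyset$, else $ub=\max\{Clock_n^m,HLC_n^m\}$. If $Committed_n^m\ne\emptyset$, then for the transactions in $Committed_n^m$ with $ct\le ub$, grouped by $ct$ and in increasing order of $ct$: it installs (inserts in the version chain of the key) their versions with $ut=ct$, sends one Replicate message per group (all updates of the group, with $ct$) to the other replicas of partition $n$, and removes the group from $Committed_n^m$; then it sets $VV_n^m[r]\gets ub$. If $Committed_n^m=\emptyset$, it sets $VV_n^m[r]\gets ub$ and sends a Heartbeat with value $ub$ to the other replicas. On receipt of Replicate with timestamp $ct$ (resp. Heartbeat with value $t$) from the $i$-th replica, a server installs the contained versions and sets $VV_n^m[i]\gets ct$ (resp. sets $VV_n^m[i]\gets t$). **Stabilization (UST).** Periodically, the servers of each DC compute, from (possibly old) values of the version vectors of all servers of that DC, the minimum over all these servers and all $R$ entries (the DC's global stable time GST); the DCs exchange their GSTs; periodically each server sets $ust_n^m\gets\max\{ust_n^m, \min \text{ over all DCs of the (possibly old) received GSTs}\}$, where values not yet received count as $0$. **Snapshot visible to $T$.** Let $T$ be a transaction of client $c$ with snapshot timestamp $sn_T$. An admissible choice selects for each partition one of its replicas and a time at or after the moment the coordinator assigned $sn_T$. For such a choice, $S_T$ is the set of all versions $d$ such that either $d.ut\le sn_T$ and $d$ has been installed by the selected replica of $partition(d.k)$ by the selected time, or $d$ was written by $c$ in an earlier committed transaction and $d.ut>sn_T$ (the client's own writes not yet in the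 stable snapshot, kept in its cache). **Atomic updates (paper's definition).** If a transaction writes $X$ and $Y$, then any snapshot visible to other transactions either includes both $X$ and $Y$, or none of them. *)

(* Defs.v *)
From HB Require Import structures.
From mathcomp Require Import all_boot.

Set Implicit Arguments.
Unset Strict Implicit.
Unset Printing Implicit Defensive.

(* Replica [r] of partition [n] lives in data center [placement n r]; the server
   p_n^m is therefore named by the pair (n, r) with [placement n r = m]. *)
Record system := System {
  keyT : eqType;
  valT : eqType;
  clientT : eqType;
  nparts : nat;
  ndcs : nat;
  nreps : nat;
  partition_of : keyT -> 'I_nparts;
  placement : 'I_nparts -> 'I_nreps -> 'I_ndcs;
  placement_inj : forall n, injective (placement n);
  home : clientT -> 'I_ndcs
}.

Definition upd (A : eqType) (B : Type) (f : A -> B) (a : A) (b : B) : A -> B :=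
  fun x => if x == a then b else f x.

Definition is_min (I : finType) (P : pred I) (f : I -> nat) (g : nat) : Prop :=
  (exists2 i, P i & f i = g) /\ (forall i, P i -> g <= f i).

Section Paris.

Variable S : system.

Local Notation K := (keyT S).
Local Notation V := (valT S).
Local Notation C := (clientT S).
Local Notation part := (@partition_of S).

Local Notation server := ('I_(nparts S) * 'I_(nreps S))%type.
Definition dc (s : server) : 'I_(ndcs S) := placement s.1 s.2.

Local Notation node := (C + server)%type.

Definition tid := nat.

(* ** Item versions *)

Record version := Version {
  v_key : K;
  v_val : V;
  v_ut : nat;
  v_tid : tid;
  v_sr : 'I_(ndcs S)
}.

Definition version_tuple (d : version) :=
  (v_key d, v_val d, v_ut d, v_tid d, v_sr d).
Definition tuple_version (x : K * V * nat * tid * 'I_(ndcs S)) :=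
  let: (k, v, ut, id, sr) := x in Version k v ut id sr.
Lemma version_tupleK : cancel version_tuple tuple_version.
Proof. by case. Qed.
HB.instance Definition _ := Equality.copy version (can_type version_tupleK).

Definition vle (d d' : version) : bool :=
  (v_ut d < v_ut d') ||
  ((v_ut d == v_ut d') &&
   ((v_tid d < v_tid d') ||
    ((v_tid d == v_tid d') && (v_sr d <= v_sr d')))).

(* [None] is the answer when no version of [k] is old enough. *)
Definition freshest (store : seq version) (k : K) (sn : nat)
    (o : option version) : Prop :=
  let cand d := [&& d \in store, v_key d == k & v_ut d <= sn] in
  match o with
  | Some d => cand d /\ (forall d', cand d' -> vle d' d)
  | None => forall d', ~~ cand d'
  end.

Definition updates := seq (K * V).

(* The version vector, indexed by the replicas of the server's partition. *)
Definition vvec := {ffun 'I_(nreps S) -> nat}.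

(* ** Messages *)

Inductive msg :=
(* client -> coordinator *)
| MStart of nat                            (* ust_c *)
| MRead of tid & seq K
| MCommitReq of tid & nat & updates        (* hwt_c, WS_c *)
(* coordinator -> client *)
| MStarted of tid & nat                    (* sn_T *)
| MReadResp of tid & K & option version
| MCommitted of tid & nat                  (* ct *)
(* coordinator -> replica or cohort *)
| MReadSlice of tid & nat & K              (* sn_T *)
| MPrepare of tid & nat & nat & updates    (* sn_T, ht *)
| MCommit of tid & nat                     (* ct *)
(* replica or cohort -> coordinator *)
| MReadSliceResp of tid & K & option version
| MPrepared of tid & nat                   (* pt *)
(* replica -> replica of the same partition *)
| MReplicate of nat & seq version          (* ct *)
| MHeartbeat of nat.

(* [net p q] is the content of the FIFO channel from [p] to [q], oldest message
   first. *)
Definition network := node -> node -> seq msg.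

Definition send (net : network) (p : node) (out : node -> seq msg) : network :=
  fun x y => if x == p then net x y ++ out y else net x y.

Definition dequeue (net : network) (p q : node) : network :=
  fun x y => if (x == p) && (y == q) then behead (net x y) else net x y.

Definition to (q : node) (m : msg) : node -> seq msg :=
  fun y => if y == q then [:: m] else [::].

Definition to_servers (f : server -> seq msg) : node -> seq msg :=
  fun y => if y is inr s then f s else [::].

(* ** Servers *)

(* A transaction held by a cohort; [e_ts] is pt in Prepared and ct in
   Committed. *)
Record entry := Entry { e_tid : tid; e_ts : nat; e_ups : updates }.

(* [sv_clock] is a strict upper bound of the clock readings made so far (0 before
   the first one): the next reading can be any number >= [sv_clock].
   [sv_gst m] is the GST of data center [m] currently known to the server. *)
Record server_state := ServerState {
  sv_clock : nat;
  sv_hlc : nat;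
  sv_vv : vvec;
  sv_ust : nat;
  sv_prep : seq entry;
  sv_comm : seq entry;
  sv_store : seq version;
  sv_gst : 'I_(ndcs S) -> nat
}.

Definition server0 : server_state :=
  ServerState 0 0 [ffun=> 0] 0 [::] [::] [::] (fun=> 0).

Definition raise_ust (x : server_state) (u : nat) : server_state :=
  ServerState (sv_clock x) (sv_hlc x) (sv_vv x) (maxn (sv_ust x) u)
    (sv_prep x) (sv_comm x) (sv_store x) (sv_gst x).

Definition receive_gst (x : server_state) (m : 'I_(ndcs S)) (g : nat) :
    server_state :=
  ServerState (sv_clock x) (sv_hlc x) (sv_vv x) (sv_ust x)
    (sv_prep x) (sv_comm x) (sv_store x) (upd (sv_gst x) m g).

(* In the following handlers [clk] is the reading of the physical clock. *)

Definition prepare_hlc (x : server_state) (clk ht : nat) : nat :=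
  maxn clk (maxn ht.+1 (sv_hlc x).+1).

Definition proposal (x : server_state) (clk sn ht : nat) : nat :=
  maxn (prepare_hlc x clk ht) (maxn (sv_ust x) sn).

Definition prepare (x : server_state) (clk : nat) (T : tid) (sn ht : nat)
    (ups : updates) : server_state :=
  ServerState clk.+1 (prepare_hlc x clk ht) (sv_vv x) (maxn (sv_ust x) sn)
    (Entry T (proposal x clk sn ht) ups :: sv_prep x)
    (sv_comm x) (sv_store x) (sv_gst x).

Definition commit (x : server_state) (clk : nat) (T : tid) (ct : nat) :
    server_state :=
  ServerState clk.+1 (maxn (sv_hlc x) (maxn ct clk)) (sv_vv x) (sv_ust x)
    [seq e <- sv_prep x | e_tid e != T]
    ([seq Entry T ct (e_ups e) | e <- sv_prep x & e_tid e == T] ++ sv_comm x)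
    (sv_store x) (sv_gst x).

Definition set_vv (vv : vvec) (i : 'I_(nreps S)) (t : nat) : vvec :=
  [ffun j => if j == i then t else vv j].

Definition upper_bound (x : server_state) (clk : nat) : nat :=
  if sv_prep x is e :: es then (foldr minn (e_ts e) (map e_ts es)).-1
  else maxn clk (sv_hlc x).

Definition apply_clock (x : server_state) (clk : nat) : nat :=
  if sv_prep x is [::] then clk.+1 else sv_clock x.

Definition make_versions (m : 'I_(ndcs S)) (ct : nat) (T : tid) (ups : updates) :
    seq version :=
  [seq Version kv.1 kv.2 ct T m | kv <- ups].

Definition group (s : server) (x : server_state) (ct : nat) : seq version :=
  flatten [seq make_versions (dc s) (e_ts e) (e_tid e) (e_ups e)
          | e <- sv_comm x & e_ts e == ct].

Definition group_times (x : server_state) (ub : nat) : seq nat :=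
  sort leq (undup [seq e_ts e | e <- sv_comm x & e_ts e <= ub]).

Definition apply_updates (s : server) (x : server_state) (clk : nat) :
    server_state :=
  let ub := upper_bound x clk in
  ServerState (apply_clock x clk) (sv_hlc x) (set_vv (sv_vv x) s.2 ub)
    (sv_ust x) (sv_prep x) [seq e <- sv_comm x | ub < e_ts e]
    (sv_store x ++ flatten [seq group s x ct | ct <- group_times x ub])
    (sv_gst x).

Definition apply_messages (s : server) (x : server_state) (clk : nat) : seq msg :=
  let ub := upper_bound x clk in
  if sv_comm x is [::] then [:: MHeartbeat ub]
  else [seq MReplicate ct (group s x ct) | ct <- group_times x ub].

Definition to_replicas (s : server) (ms : seq msg) : node -> seq msg :=
  to_servers (fun s' => if (s'.1 == s.1) && (s'.2 != s.2) then ms else [::]).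

Definition replicate (x : server_state) (i : 'I_(nreps S)) (t : nat)
    (ds : seq version) : server_state :=
  ServerState (sv_clock x) (sv_hlc x) (set_vv (sv_vv x) i t) (sv_ust x)
    (sv_prep x) (sv_comm x) (sv_store x ++ ds) (sv_gst x).

(* ** Clients *)

(* The client's copy of a version; [ci_ut] is [None] for a buffered write. *)
Record citem := CItem { ci_key : K; ci_val : V; ci_ut : option nat }.

Inductive client_status :=
| Ready
| Starting
| Reading of seq K     (* keys not yet answered *)
| Committing.

(* [cl_txn] is the current transaction together with its coordinator. *)
Record client_state := ClientState {
  cl_status : client_status;
  cl_txn : option (tid * server);
  cl_ust : nat;
  cl_hwt : nat;
  cl_wc : seq citem;
  cl_rs : seq citem;
  cl_ws : seq citem
}.

Definition client0 : client_state :=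
  ClientState Ready None 0 0 [::] [::] [::].

Definition set_status (x : client_state) (w : client_status) : client_state :=
  ClientState w (cl_txn x) (cl_ust x) (cl_hwt x) (cl_wc x) (cl_rs x) (cl_ws x).

Definition client_started (x : client_state) (T : tid) (s : server) (sn : nat) :
    client_state :=
  ClientState Ready (Some (T, s)) sn (cl_hwt x)
    [seq e <- cl_wc x | sn < odflt 0 (ci_ut e)] [::] [::].

Definition client_write (x : client_state) (k : K) (v : V) : client_state :=
  ClientState (cl_status x) (cl_txn x) (cl_ust x) (cl_hwt x) (cl_wc x) (cl_rs x)
    (CItem k v None :: [seq e <- cl_ws x | ci_key e != k]).

Definition lookup (x : client_state) (k : K) : option citem :=
  ohead [seq e <- cl_ws x ++ cl_rs x ++ cl_wc x | ci_key e == k].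

Definition missing (x : client_state) (ks : seq K) : seq K :=
  [seq k <- undup ks | ~~ isSome (lookup x k)].

Definition reading (ks : seq K) : client_status :=
  if ks is [::] then Ready else Reading ks.

Definition client_read (x : client_state) (ks : seq K) : client_state :=
  ClientState (reading (missing x ks)) (cl_txn x) (cl_ust x) (cl_hwt x) (cl_wc x)
    (cl_rs x ++ pmap (lookup x) (undup ks)) (cl_ws x).

Definition client_read_resp (x : client_state) (ks : seq K) (k : K)
    (o : option version) : client_state :=
  ClientState (reading (rem k ks)) (cl_txn x) (cl_ust x) (cl_hwt x) (cl_wc x)
    (if o is Some d then rcons (cl_rs x) (CItem (v_key d) (v_val d) (Some (v_ut d)))
     else cl_rs x)
    (cl_ws x).

Definition client_committed (x : client_state) (ct : nat) : client_state :=
  ClientState Ready None (cl_ust x) ct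
    ([seq CItem (ci_key e) (ci_val e) (Some ct) | e <- cl_ws x] ++
     [seq e <- cl_wc x | ci_key e \notin map ci_key (cl_ws x)])
    (cl_rs x) [::].

(* ** Coordinators *)

(* What the coordinator knows about a transaction.  [tx_cohort n] is the replica
   picked for partition [n] and [tx_prop n] the time it proposed; both are
   relevant only for the partitions in [tx_parts]. *)
Record txn := Txn {
  tx_client : C;
  tx_sn : nat;
  tx_writes : updates;
  tx_cohort : 'I_(nparts S) -> option 'I_(nreps S);
  tx_prop : 'I_(nparts S) -> option nat;
  tx_ct : option nat
}.

Definition txn0 (c : C) (sn : nat) : txn :=
  Txn c sn [::] (fun=> None) (fun=> None) None.

Definition touched (ws : updates) (n : 'I_(nparts S)) : bool :=
  has (fun kv => part kv.1 == n) ws.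

Definition tx_parts (x : txn) (n : 'I_(nparts S)) : bool :=
  touched (tx_writes x) n.

Definition is_cohort (x : txn) (s : server) : bool :=
  tx_parts x s.1 && (tx_cohort x s.1 == Some s.2).

Definition begin_commit (x : txn) (ws : updates)
    (co : 'I_(nparts S) -> 'I_(nreps S)) : txn :=
  Txn (tx_client x) (tx_sn x) ws
    (fun n => if touched ws n then Some (co n) else None)
    (fun=> None) None.

Definition prepare_messages (x : txn) (T : tid) (ht : nat) : node -> seq msg :=
  to_servers (fun s =>
    if is_cohort x s
    then [:: MPrepare T (tx_sn x) ht [seq kv <- tx_writes x | part kv.1 == s.1]]
    else [::]).

(* The commit time, as soon as every cohort has answered. *)
Definition decision (x : txn) (prop : 'I_(nparts S) -> option nat) : option nat :=
  if [forall n, tx_parts x n ==> isSome (prop n)]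
  then Some (\max_(n | tx_parts x n) odflt 0 (prop n))
  else None.

Definition add_proposal (x : txn) (n : 'I_(nparts S)) (pt : nat) : txn :=
  let prop := upd (tx_prop x) n (Some pt) in
  Txn (tx_client x) (tx_sn x) (tx_writes x) (tx_cohort x) prop (decision x prop).

Definition decision_messages (x : txn) (T : tid) : node -> seq msg :=
  fun y =>
    if tx_ct x is Some ct then
      match y with
      | inl c => if c == tx_client x then [:: MCommitted T ct] else [::]
      | inr s => if is_cohort x s then [:: MCommit T ct] else [::]
      end
    else [::].

(* ** Global states and steps *)

(* [st_txn T] belongs to the coordinator of [T] (transaction ids being unique,
   the tables of all coordinators are merged) and is kept forever.
   [st_vvs s] collects the version vectors that server [s] has reported to its
   data center, and [st_gsts m] the GSTs computed and sent out by data center [m];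
   as nothing is ever removed, they can be used with an arbitrary delay. *)
Record state := State {
  st_srv : server -> server_state;
  st_cli : C -> client_state;
  st_net : network;
  st_txn : tid -> option txn;
  st_vvs : server -> seq vvec;
  st_gsts : 'I_(ndcs S) -> seq nat
}.

Definition state0 : state :=
  State (fun=> server0) (fun=> client0) (fun _ _ => [::]) (fun=> None)
    (fun=> [::]) (fun=> [::]).

Definition set_srv (st : state) (s : server) (x : server_state) : state :=
  State (upd (st_srv st) s x) (st_cli st) (st_net st) (st_txn st)
    (st_vvs st) (st_gsts st).
Definition set_cli (st : state) (c : C) (x : client_state) : state :=
  State (st_srv st) (upd (st_cli st) c x) (st_net st) (st_txn st)
    (st_vvs st) (st_gsts st).
Definition set_net (st : state) (net : network) : state :=
  State (st_srv st) (st_cli st) net (st_txn st) (st_vvs st) (st_gsts st).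
Definition set_txn (st : state) (T : tid) (x : txn) : state :=
  State (st_srv st) (st_cli st) (st_net st) (upd (st_txn st) T (Some x))
    (st_vvs st) (st_gsts st).

Definition post (st : state) (p : node) (out : node -> seq msg) : state :=
  set_net st (send (st_net st) p out).

Definition report_vv (st : state) (s : server) : state :=
  State (st_srv st) (st_cli st) (st_net st) (st_txn st)
    (upd (st_vvs st) s (sv_vv (st_srv st s) :: st_vvs st s)) (st_gsts st).

Definition add_gst (st : state) (m : 'I_(ndcs S)) (g : nat) : state :=
  State (st_srv st) (st_cli st) (st_net st) (st_txn st) (st_vvs st)
    (upd (st_gsts st) m (g :: st_gsts st m)).

Definition inC (c : C) : node := inl c.
Definition inS (s : server) : node := inr s.

(* Spontaneous events: client operations, and periodic server activities. *)
Inductive internal (st : state) : state -> Prop :=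
| IStart c s :
    cl_status (st_cli st c) = Ready ->
    dc s = home c ->
    internal st
      (post (set_cli st c (set_status (st_cli st c) Starting))
         (inC c) (to (inS s) (MStart (cl_ust (st_cli st c)))))
| IRead c T s ks :
    cl_status (st_cli st c) = Ready ->
    cl_txn (st_cli st c) = Some (T, s) ->
    internal st
      (post (set_cli st c (client_read (st_cli st c) ks))
         (inC c)
         (if missing (st_cli st c) ks is [::] then fun=> [::]
          else to (inS s) (MRead T (missing (st_cli st c) ks))))
| IWrite c T s k v :
    cl_status (st_cli st c) = Ready ->
    cl_txn (st_cli st c) = Some (T, s) ->
    internal st (set_cli st c (client_write (st_cli st c) k v))
| ICommit c T s e ws :
    cl_status (st_cli st c) = Ready ->
    cl_txn (st_cli st c) = Some (T, s) ->
    cl_ws (st_cli st c) = e :: ws ->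
    internal st
      (post (set_cli st c (set_status (st_cli st c) Committing))
         (inC c)
         (to (inS s)
            (MCommitReq T (cl_hwt (st_cli st c))
               [seq (ci_key e, ci_val e) | e <- cl_ws (st_cli st c)])))
| IApply s clk :
    sv_clock (st_srv st s) <= clk ->
    internal st
      (post (set_srv st s (apply_updates s (st_srv st s) clk))
         (inS s) (to_replicas s (apply_messages s (st_srv st s) clk)))
| IReport s :
    internal st (report_vv st s)
| IGst m (vv : server -> vvec) g :
    (forall s, dc s = m -> vv s \in st_vvs st s) ->
    is_min (fun i : server * 'I_(nreps S) => dc i.1 == m)
           (fun i => vv i.1 i.2) g ->
    internal st (add_gst st m g)
| IReceiveGst s m g :
    g \in st_gsts st m ->
    internal st (set_srv st s (receive_gst (st_srv st s) m g))
| IUst s u :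
    is_min predT (sv_gst (st_srv st s)) u ->
    internal st (set_srv st s (raise_ust (st_srv st s) u)).

(* [deliver p q m st st']: node [q] handles the message [m] received from [p];
   [st] is the state after the removal of [m] from the channel. *)
Inductive deliver : node -> node -> msg -> state -> state -> Prop :=
| DStart st c s u T :
    st_txn st T = None ->
    let x := raise_ust (st_srv st s) u in
    deliver (inC c) (inS s) (MStart u) st
      (post (set_txn (set_srv st s x) T (txn0 c (sv_ust x)))
         (inS s) (to (inC c) (MStarted T (sv_ust x))))
| DStarted st c s T sn :
    cl_status (st_cli st c) = Starting ->
    deliver (inS s) (inC c) (MStarted T sn) st
      (set_cli st c (client_started (st_cli st c) T s sn))
| DRead st c s T x ks (pick : K -> 'I_(nreps S)) :
    st_txn st T = Some x ->
    deliver (inC c) (inS s) (MRead T ks) st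
      (post st (inS s)
         (to_servers (fun s' =>
            [seq MReadSlice T (tx_sn x) k
            | k <- ks & (part k == s'.1) && (pick k == s'.2)])))
| DReadSlice st s s' T sn k o :
    freshest (sv_store (st_srv st s')) k sn o ->
    deliver (inS s) (inS s') (MReadSlice T sn k) st
      (post (set_srv st s' (raise_ust (st_srv st s') sn))
         (inS s') (to (inS s) (MReadSliceResp T k o)))
| DReadSliceResp st s s' T x k o :
    st_txn st T = Some x ->
    deliver (inS s') (inS s) (MReadSliceResp T k o) st
      (post st (inS s) (to (inC (tx_client x)) (MReadResp T k o)))
| DReadResp st c s T k o ks :
    cl_status (st_cli st c) = Reading ks ->
    deliver (inS s) (inC c) (MReadResp T k o) st
      (set_cli st c (client_read_resp (st_cli st c) ks k o))
| DCommitReq st c s T x hwt ws (co : 'I_(nparts S) -> 'I_(nreps S)) :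
    st_txn st T = Some x ->
    let x' := begin_commit x ws co in
    deliver (inC c) (inS s) (MCommitReq T hwt ws) st
      (post (set_txn st T x')
         (inS s) (prepare_messages x' T (maxn (tx_sn x) hwt)))
| DPrepare st s s' T sn ht ups clk :
    sv_clock (st_srv st s') <= clk ->
    deliver (inS s) (inS s') (MPrepare T sn ht ups) st
      (post (set_srv st s' (prepare (st_srv st s') clk T sn ht ups))
         (inS s')
         (to (inS s) (MPrepared T (proposal (st_srv st s') clk sn ht))))
| DPrepared st s s' T x pt :
    st_txn st T = Some x ->
    let x' := add_proposal x s'.1 pt in
    deliver (inS s') (inS s) (MPrepared T pt) st
      (post (set_txn st T x') (inS s) (decision_messages x' T))
| DCommit st s s' T ct clk :
    sv_clock (st_srv st s') <= clk ->
    deliver (inS s) (inS s') (MCommit T ct) st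
      (set_srv st s' (commit (st_srv st s') clk T ct))
| DCommitted st c s T ct :
    cl_status (st_cli st c) = Committing ->
    deliver (inS s) (inC c) (MCommitted T ct) st
      (set_cli st c (client_committed (st_cli st c) ct))
| DReplicate st s s' ct ds :
    deliver (inS s) (inS s') (MReplicate ct ds) st
      (set_srv st s' (replicate (st_srv st s') s.2 ct ds))
| DHeartbeat st s s' t :
    deliver (inS s) (inS s') (MHeartbeat t) st
      (set_srv st s' (replicate (st_srv st s') s.2 t [::])).

Inductive step (st : state) : state -> Prop :=
| SInternal st' : internal st st' -> step st st'
| SDeliver p q m ms st' :
    st_net st p q = m :: ms ->
    deliver p q m (set_net st (dequeue (st_net st) p q)) st' ->
    step st st'.

(* Stuttering makes finite executions a special case of infinite ones.  No
   fairness is required, so message delays need not even be finite. *)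
Definition execution (run : nat -> state) : Prop :=
  run 0 = state0 /\
  forall t, run t.+1 = run t \/ step (run t) (run t.+1).

(* ** Snapshots *)

(* The versions written by [T]; empty as long as [T] has not committed.  The
   source [v_sr] is the data center of the cohort. *)
Definition written (T : tid) (x : txn) : seq version :=
  if tx_ct x is Some ct then
    pmap (fun kv =>
            omap (fun r => Version kv.1 kv.2 ct T (placement (part kv.1) r))
              (tx_cohort x (part kv.1)))
      (tx_writes x)
  else [::].

(* One replica and one time for every partition. *)
Definition serving := 'I_(nparts S) -> 'I_(nreps S) * nat.

Definition admissible (run : nat -> state) (T : tid) (ch : serving) : Prop :=
  forall n, st_txn (run (ch n).2) T <> None.

Definition installed (run : nat -> state) (ch : serving) (d : version) : Prop :=
  let n := part (v_key d) in
  d \in sv_store (st_srv (run (ch n).2) (n, (ch n).1)).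

Definition own_earlier (run : nat -> state) (T : tid) (c : C) (d : version) :
    Prop :=
  exists t T1 x1,
    [/\ st_txn (run t) T1 = Some x1, tx_client x1 = c,
        d \in written T1 x1 & st_txn (run t) T = None].

(* [d] belongs to the snapshot visible to [T], whose record is [x]. *)
Definition in_snapshot (run : nat -> state) (T : tid) (x : txn) (ch : serving)
    (d : version) : Prop :=
  (v_ut d <= tx_sn x /\ installed run ch d) \/
  (tx_sn x < v_ut d /\ own_earlier run T (tx_client x) d).

End Paris.

(* Main.v *)
Require Import Defs.
From HB Require Import structures.
From mathcomp Require Import all_boot zify.
From Stdlib Require Import FunctionalExtensionality Classical_Prop.

(* The heart of the argument is that the entry of a replica's version vector for
   its own updates is smaller than the timestamp of everything it has still to
   install: than the proposals of its prepared transactions, than the commit times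
   of its committed ones, and than whatever it will propose later.  Since channels
   are FIFO, the copy of this entry at another replica is smaller than the
   timestamp of every update still on its way there.  Every snapshot timestamp
   is, through the UST, a lower bound of all version vectors of the system.  So a
   transaction whose commit time is at most sn_T is installed at all replicas of
   the partitions it writes, and a transaction with a larger commit time can
   contribute to S_T only through the cache of its own client, which receives all
   of its writes at once. *)

Set Implicit Arguments.
Unset Strict Implicit.
Unset Printing Implicit Defensive.

Section Paris.

Context (S : system).

Local Notation C := (clientT S).
Local Notation part := (@partition_of S).
Local Notation server := ('I_(nparts S) * 'I_(nreps S))%type.
Local Notation node := (C + server)%type.
Local Notation inC := (@inC S).
Local Notation inS := (@inS S).
Implicit Types (k : pred (msg S)) (net : network S) (m : msg S) (st : state S).

(** That a commit time is at least every proposal holds only if the commit protocol runs at most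
    once for each transaction: the coordinator resets the proposals on every request and recomputes
    the commit time on every vote, so a repeated message could change a decision already announced.
    Unique ids and sequential clients exclude this. The exclusion is expressed by counting messages
    in flight: the right to request a commit is a token with at most one copy, and a vote awaited
    from a cohort corresponds to exactly one message.

    The serving time of a read is arbitrary, so it may precede the decision on T'. Then ct must
    exceed sn_T: a cohort's own entry is still below ct when the decision falls, and it never
    decreases, so it was below ct at all earlier times.

    Reports, GSTs and messages may be arbitrarily stale; monotonicity of the version vectors makes
    this harmless. *)

Definition entry_tuple (e : entry S) := (e_tid e, e_ts e, e_ups e).
Definition tuple_entry (x : tid * nat * updates S) : entry S :=
  let: (T, t, ups) := x in Entry T t ups.
Lemma entry_tupleK : cancel entry_tuple tuple_entry.
Proof. by case. Qed.
HB.instance Definition _ := Equality.copy (entry S) (can_type entry_tupleK).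

Lemma msg_comparable : comparable (msg S).
Proof. rewrite /comparable /decidable; decide equality; exact: eq_comparable. Qed.
HB.instance Definition _ := hasDecEq.Build (msg S) (compareP msg_comparable).

(** * Channels *)

Lemma updE (A : eqType) (B : Type) (f : A -> B) a b x :
  upd f a b x = if x == a then b else f x.
Proof. by []. Qed.

Lemma upd_proj (A : eqType) (B D : Type) (h : B -> D) (f : A -> B) a b :
  h b = h (f a) -> (fun x => h (upd f a b x)) = (fun x => h (f x)).
Proof.
by move=> hb; apply: functional_extensionality => x; rewrite /upd;
  case: eqP => // ->.
Qed.

Lemma upd_map (A : eqType) (B D : Type) (h : B -> D) (f : A -> B) a b :
  (fun x => h (upd f a b x)) = upd (fun x => h (f x)) a (h b).
Proof. by apply: functional_extensionality => x; rewrite /upd; case: eqP. Qed.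

(* The invariants speak of the channels restricted to the relevant kinds of
   messages, so that an event involving only other kinds leaves them unchanged. *)
Definition restrict k (net : network S) : network S :=
  fun x y => filter k (net x y).

Definition restrict_out (k : pred (msg S)) (out : node -> seq (msg S)) :=
  fun y => filter k (out y).

Lemma network_ext (net net' : network S) : (forall x y, net x y = net' x y) ->
  net = net'.
Proof. by move=> e; do 2!apply: functional_extensionality => ?. Qed.

Lemma restrict_send k net p out :
  restrict k (send net p out) = send (restrict k net) p (restrict_out k out).
Proof.
by apply: network_ext => x y; rewrite /restrict /send; case: eqP => // _;
  rewrite filter_cat.
Qed.

Lemma send0 (net : network S) p (out : node -> seq (msg S)) :
  (forall y, out y = [::]) -> send net p out = net.
Proof.
by move=> o0; apply: network_ext => x y; rewrite /send o0 cats0; case: eqP.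
Qed.

Lemma restrict_send0 k net p out :
  (forall y, filter k (out y) = [::]) -> restrict k (send net p out) = restrict k net.
Proof. by move=> o0; rewrite restrict_send send0. Qed.

Lemma restrict_out_to k q m :
  restrict_out k (to q m) = if k m then to q m else fun=> [::].
Proof.
apply: functional_extensionality => y; rewrite /restrict_out.
by case km: (k m); rewrite /to; case: eqP => //= _; rewrite km.
Qed.

Lemma restrict_dequeue k net p q m ms : net p q = m :: ms ->
  restrict k (dequeue net p q) =
  if k m then dequeue (restrict k net) p q else restrict k net.
Proof.
move=> e; apply: network_ext => x y; case: ifP => km; rewrite /restrict /dequeue.
  by case: andP => // -[/eqP-> /eqP->]; rewrite e /= km.
by case: andP => // -[/eqP-> /eqP->]; rewrite e /= km.
Qed.

Lemma restrict_head k (net : network S) p q m ms : net p q = m :: ms -> k m ->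
  restrict k net p q = m :: filter k ms.
Proof. by rewrite /restrict => -> /= ->. Qed.

Lemma sendE (net : network S) p out x y :
  send net p out x y = net x y ++ (if x == p then out y else [::]).
Proof. by rewrite /send; case: eqP => // _; rewrite cats0. Qed.

Lemma mem_send (net : network S) p out x y m :
  (m \in send net p out x y) = (m \in net x y) || (x == p) && (m \in out y).
Proof. by rewrite sendE mem_cat; case: eqP. Qed.

Lemma count_send P (net : network S) p out x y :
  count P (send net p out x y) = count P (net x y) + (x == p) * count P (out y).
Proof. by rewrite sendE count_cat; case: eqP => _; rewrite ?mul1n ?mul0n. Qed.

Lemma count_dequeue P (net : network S) p q m ms x y : net p q = m :: ms ->
  count P (net x y) = [&& x == p, y == q & P m] + count P (dequeue net p q x y).
Proof.
move=> e; rewrite /dequeue; case: (eqVneq x p) => [->|_] //=.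
by case: (eqVneq y q) => [->|_] //=; rewrite e.
Qed.

Lemma mem_dequeue (net : network S) p q x y m :
  m \in dequeue net p q x y -> m \in net x y.
Proof. by rewrite /dequeue; case: ifP => // _; apply: mem_behead. Qed.

Lemma count_to P q m y : count P (to q m y : seq (msg S)) = (y == q) * P m.
Proof. by rewrite /to; case: eqP => _ //=; lia. Qed.

Lemma mem_to q m y m' : (m' \in to q m y) = (y == q) && (m' == m :> msg S).
Proof. by rewrite /to; case: eqP => _ //=; rewrite inE. Qed.

Lemma inC_eq c c' : (inC c == inC c') = (c == c'). Proof. by []. Qed.
Lemma inS_eq s s' : (inS s == inS s') = (s == s'). Proof. by []. Qed.
Lemma inCS_eq c s : (inC c == inS s) = false. Proof. by []. Qed.
Lemma inSC_eq c s : (inS s == inC c) = false. Proof. by []. Qed.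
Definition node_eq := (inC_eq, inS_eq, inCS_eq, inSC_eq).

(** * A transaction is submitted for commit at most once *)

(** In status [Committing] the client still names the transaction in [cl_txn], but its request has
    left, and from then on only the message counts. *)
Definition held (x : client_state S) : option (tid * server) :=
  if cl_status x is Committing then None else cl_txn x.

Definition is_token (T : tid) (m : msg S) : bool :=
  match m with
  | MStarted T' _ | MCommitReq T' _ _ => T' == T
  | _ => false
  end.

(** The right to request the commit of [T] passes from the [MStarted] message to the client and on
    to the [MCommitReq] message; the summands count its copies at these three places. *)
Definition tokens (hold : C -> option (tid * server)) (net : network S)
    (T : tid) (c : C) (s : server) : nat :=
  count (is_token T) (net (inS s) (inC c)) + (hold c == Some (T, s)) +
  count (is_token T) (net (inC c) (inS s)).

Lemma tokens_dequeue hold net p q m ms T c s : net p q = m :: ms ->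
  tokens hold net T c s =
  tokens hold (dequeue net p q) T c s +
  [&& p == inS s, q == inC c & is_token T m] +
  [&& p == inC c, q == inS s & is_token T m].
Proof.
move=> e; rewrite /tokens.
have := count_dequeue (is_token T) (inS s) (inC c) e.
have := count_dequeue (is_token T) (inC c) (inS s) e.
rewrite ![_ == p]eq_sym ![_ == q]eq_sym; lia.
Qed.

(* [crd T] is the coordinator of [T], which the record of [T] does not name. *)
Record token_inv (crd : tid -> server) (hold : C -> option (tid * server))
    (tx : tid -> option (txn S)) (net : network S) : Prop := TokenInv {
  token_le1 : forall T c s, tokens hold net T c s <= 1;
  token_txn : forall T c s, 0 < tokens hold net T c s ->
    crd T = s /\ exists sn, tx T = Some (txn0 c sn)
}.

Lemma token_inv_le crd hold tx net hold' tx' net' :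
  token_inv crd hold tx net ->
  (forall T c s, tokens hold' net' T c s <= tokens hold net T c s) ->
  (forall T c s, 0 < tokens hold' net' T c s -> tx' T = tx T) ->
  token_inv crd hold' tx' net'.
Proof.
move=> [le1 txn] le eqtx; split=> [T c s|T c s gt0].
  exact: leq_trans (le _ _ _) (le1 _ _ _).
by rewrite (eqtx _ _ _ gt0); apply: txn; apply: leq_trans gt0 (le _ _ _).
Qed.

Lemma token_commit crd hold tx net c T s h ws :
  token_inv crd hold tx net -> hold c = Some (T, s) ->
  token_inv crd (upd hold c None) tx
    (send net (inC c) (to (inS s) (MCommitReq T h ws))).
Proof.
move=> inv hc; apply: (token_inv_le inv) => // T1 c1 s1.
rewrite /tokens !count_send !count_to !node_eq /= updE.
case: (eqVneq c1 c) => [->|_] /=; rewrite ?hc; last by lia.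
by rewrite -[Some _ == Some _]/((T, s) == (T1, s1)) xpair_eqE (eq_sym s1); lia.
Qed.

(** A transaction formerly held by [c] loses its token here, so counts may drop; this is why
    [token_inv_le] asks for an inequality. *)
Lemma token_started crd hold tx net c T s sn ms :
  token_inv crd hold tx net -> net (inS s) (inC c) = MStarted S T sn :: ms ->
  token_inv crd (upd hold c (Some (T, s))) tx (dequeue net (inS s) (inC c)).
Proof.
move=> inv e; apply: (token_inv_le inv) => // T1 c1 s1.
rewrite (tokens_dequeue _ _ _ _ e) !node_eq /= /tokens updE.
case: (eqVneq c1 c) => [->|_] /=; last by lia.
by rewrite -[Some _ == Some _]/((T, s) == (T1, s1)) xpair_eqE; lia.
Qed.

Lemma token_start crd hold tx net c T s sn :
  token_inv crd hold tx net -> tx T = None ->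
  token_inv (upd crd T s) hold (upd tx T (Some (txn0 c sn)))
    (send net (inS s) (to (inC c) (MStarted S T sn))).
Proof.
move=> [le1 txn] txT.
have tok0 c1 s1 : tokens hold net T c1 s1 = 0.
  by apply/eqP; rewrite -leqn0 leqNgt; apply/negP => /txn[_ [?]]; rewrite txT.
have tokE T1 c1 s1 :
    tokens hold (send net (inS s) (to (inC c) (MStarted S T sn))) T1 c1 s1 =
    tokens hold net T1 c1 s1 + [&& T1 == T, c1 == c & s1 == s].
  rewrite /tokens !count_send !count_to !node_eq /= (eq_sym T).
  lia.
split=> T1 c1 s1; rewrite tokE; first by case: eqP => [->|_];
  rewrite ?tok0 ?addn0 //=; case: andP.
rewrite !updE; case: eqP => [->|_] /=; last by rewrite addn0; apply: txn.
by rewrite tok0; case: (eqVneq c1 c) => [->|//];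
  case: (eqVneq s1 s) => [->|//] /= _; split=> //; exists sn.
Qed.

(** The request consumes the only token of [T], so the record of [T] may change freely afterwards.
    This excludes a second request. *)
Lemma token_commit_req crd hold tx net c s T h ws ms :
  token_inv crd hold tx net -> net (inC c) (inS s) = MCommitReq T h ws :: ms ->
  (forall x, token_inv crd hold (upd tx T x) (dequeue net (inC c) (inS s))) /\
  crd T = s /\ exists sn, tx T = Some (txn0 c sn).
Proof.
move=> inv e.
have gt0 : 0 < tokens hold net T c s.
  by rewrite (tokens_dequeue _ _ _ _ e) !node_eq /= !eqxx; lia.
split; last exact: (token_txn inv gt0).
move=> x; apply: (token_inv_le inv) => T1 c1 s1.
  by rewrite (tokens_dequeue _ _ _ _ e); lia.
rewrite updE; case: (eqVneq T1 T) => [->|//] gt0'.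
have gt0'' : 0 < tokens hold net T c1 s1.
  by rewrite (tokens_dequeue _ _ _ _ e); lia.
have [crd1 [sn1 tx1]] := token_txn inv gt0''.
have [crd2 [sn2 tx2]] := token_txn inv gt0.
(* The record determines the client and [crd] the coordinator, so a second token of [T] would be
   counted in the same sum, against [token_le1]. *)
have cE : c1 = c by move: tx2; rewrite tx1 => -[].
have := token_le1 inv T c s; move: gt0'; rewrite cE -crd1 crd2.
by rewrite (tokens_dequeue _ _ _ _ e) !node_eq /= !eqxx; lia.
Qed.

(** * Voting of the cohorts *)

Definition writes_at (x : txn S) (n : 'I_(nparts S)) : updates S :=
  [seq kv <- tx_writes x | part kv.1 == n].

Definition is_prepare (T : tid) m : bool :=
  if m is MPrepare T' _ _ _ then T' == T else false.

Definition is_prepared (T : tid) m : bool :=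
  if m is MPrepared T' _ then T' == T else false.

Definition ballots net (T : tid) (s s' : server) : nat :=
  count (is_prepare T) (net (inS s) (inS s')) +
  count (is_prepared T) (net (inS s') (inS s)).

Definition awaited (crd : tid -> server) (tx : tid -> option (txn S))
    (T : tid) (s s' : server) : bool :=
  if tx T is Some x then
    [&& s == crd T, is_cohort x s' & ~~ isSome (tx_prop x s'.1)]
  else false.

(** Two consequences are wanted: [e_ts e] is at most the commit time ([entry_prop] with
    [prop_le_ct]), and every cohort still has its entry when the decision falls ([prepared_entry]
    with [open_entry]). [ballot_count] rules out repeated votes: an awaited vote is in flight
    exactly once, as a question or as an answer. *)
Record ballot_inv (crd : tid -> server) (prep : server -> seq (entry S))
    (tx : tid -> option (txn S)) net : Prop := BallotInv {
  ballot_count : forall T s s', ballots net T s s' = awaited crd tx T s s';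
  prepare_writes : forall T sn ht ups s s' x,
    MPrepare T sn ht ups \in net (inS s) (inS s') -> tx T = Some x ->
    ups = writes_at x s'.1;
  prepared_entry : forall T pt s s',
    MPrepared S T pt \in net (inS s') (inS s) ->
    exists2 e, e \in prep s' & e_tid e = T;
  entry_txn : forall s' e, e \in prep s' ->
    exists x, [/\ tx (e_tid e) = Some x, is_cohort x s'
                & e_ups e = writes_at x s'.1];
  entry_unasked : forall s s' e, e \in prep s' ->
    count (is_prepare (e_tid e)) (net (inS s) (inS s')) = 0;
  entry_vote : forall s s' e pt, e \in prep s' ->
    MPrepared S (e_tid e) pt \in net (inS s') (inS s) -> pt = e_ts e;
  entry_prop : forall s' e x pt, e \in prep s' -> tx (e_tid e) = Some x ->
    tx_prop x s'.1 = Some pt -> pt = e_ts e;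
  open_entry : forall T x s', tx T = Some x -> is_cohort x s' ->
    tx_ct x = None -> isSome (tx_prop x s'.1) ->
    exists2 e, e \in prep s' & e_tid e = T;
  commit_txn : forall T ct p q, MCommit S T ct \in net p q ->
    exists2 x, tx T = Some x & tx_ct x = Some ct;
  prop_le_ct : forall T x ct n, tx T = Some x -> tx_ct x = Some ct ->
    tx_parts x n -> exists2 pt, tx_prop x n = Some pt & pt <= ct
}.

Lemma prepare_count T sn ht ups (ms : seq (msg S)) :
  MPrepare T sn ht ups \in ms -> 0 < count (is_prepare T) ms.
Proof. by move=> h; rewrite -has_count; apply/hasP;
  exists (MPrepare T sn ht ups) => //=. Qed.

Lemma prepared_count T pt (ms : seq (msg S)) :
  MPrepared S T pt \in ms -> 0 < count (is_prepared T) ms.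
Proof. by move=> h; rewrite -has_count; apply/hasP;
  exists (MPrepared S T pt) => //=. Qed.

Lemma ballots_dequeue net p q m ms T s s' : net p q = m :: ms ->
  ballots net T s s' =
  ballots (dequeue net p q) T s s' +
  [&& p == inS s, q == inS s' & is_prepare T m] +
  [&& p == inS s', q == inS s & is_prepared T m].
Proof.
move=> e; rewrite /ballots.
have := count_dequeue (is_prepare T) (inS s) (inS s') e.
have := count_dequeue (is_prepared T) (inS s') (inS s) e.
rewrite ![_ == p]eq_sym ![_ == q]eq_sym; lia.
Qed.

Lemma ballots_send net p out T s s' :
  ballots (send net p out) T s s' =
  ballots net T s s' + (inS s == p) * count (is_prepare T) (out (inS s')) +
  (inS s' == p) * count (is_prepared T) (out (inS s)).
Proof. by rewrite /ballots !count_send; lia. Qed.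

Lemma is_cohort0 c sn s : is_cohort (txn0 (S := S) c sn) s = false.
Proof. by []. Qed.

Lemma is_cohort_inj (x : txn S) s s' :
  is_cohort x s -> is_cohort x s' -> s.1 = s'.1 -> s = s'.
Proof.
case: s s' => n r [n' r'] /andP[_ /eqP /= e] /andP[_ /eqP /= e'] /= nn.
by move: e; rewrite nn e' => -[->].
Qed.

Lemma prepare_awaited crd prep tx net T sn ht ups s s' :
  ballot_inv crd prep tx net -> MPrepare T sn ht ups \in net (inS s) (inS s') ->
  awaited crd tx T s s'.
Proof.
by move=> inv /prepare_count; have := ballot_count inv T s s'; rewrite /ballots;
  lia.
Qed.

Lemma prepared_awaited crd prep tx net T pt s s' :
  ballot_inv crd prep tx net -> MPrepared S T pt \in net (inS s') (inS s) ->
  awaited crd tx T s s'.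
Proof.
by move=> inv /prepared_count; have := ballot_count inv T s s'; rewrite /ballots;
  lia.
Qed.

(** By [prop_le_ct] a decided transaction has all its proposals, so a missing one shows that it is
    still open. *)
Lemma awaited_open crd prep tx net T s s' x : ballot_inv crd prep tx net ->
  awaited crd tx T s s' -> tx T = Some x ->
  [/\ s = crd T, is_cohort x s', tx_prop x s'.1 = None & tx_ct x = None].
Proof.
move=> inv; rewrite /awaited => /[swap] txT; rewrite txT => /and3P[/eqP-> co np].
split=> //; first by case: (tx_prop _ _) np.
case ct: (tx_ct x) => [c|//]; case/andP: (co) => px _.
by have [pt e] := prop_le_ct inv txT ct px; rewrite e in np.
Qed.

Lemma ballot_start crd prep tx net T s c sn :
  ballot_inv crd prep tx net -> tx T = None ->
  ballot_inv (upd crd T s) prep (upd tx T (Some (txn0 c sn))) net.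
Proof.
move=> inv txT; split.
- move=> T1 s1 s1'; rewrite (ballot_count inv) /awaited !updE.
  by case: (eqVneq T1 T) => [->|//]; rewrite txT is_cohort0 andbF.
- move=> T1 sn1 ht ups s1 s1' x mT; rewrite updE;
    case: eqP => [T1E|_ /(prepare_writes inv mT)//].
  by have := prepare_awaited inv mT; rewrite /awaited T1E txT.
- exact: (prepared_entry inv).
- move=> s1 e /(entry_txn inv)[x [ex cx ux]]; exists x; split=> //.
  by rewrite updE; case: eqP => // eT; move: ex; rewrite eT txT.
- exact: (entry_unasked inv).
- exact: (entry_vote inv).
- move=> s1 e x pt eP; rewrite updE; case: eqP => [eT|_];
    last exact: (entry_prop inv eP).
  by have [y [ey _ _]] := entry_txn inv eP; rewrite -eT ey in txT.
- move=> T1 x s1; rewrite updE; case: eqP => [_ [<-]//|_];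
    exact: (open_entry inv).
- move=> T1 ct p q /(commit_txn inv)[x ex cx]; exists x => //.
  by rewrite updE; case: eqP => // eT; move: ex; rewrite eT txT.
- move=> T1 x ct n; rewrite updE; case: eqP => [_ [<-]//|_];
    exact: (prop_le_ct inv).
Qed.

Lemma mem_prepare_messages x T ht y m : m \in prepare_messages (S :=
  S) x T ht y ->
  exists2 s, y = inS s &
    is_cohort x s /\ m = MPrepare T (tx_sn x) ht (writes_at x s.1).
Proof.
case: y => // s; rewrite /prepare_messages /=; case: ifP => // co.
by rewrite inE => /eqP->; exists s.
Qed.

(** A record [txn0] has no cohort, so no entry, ballot or commit message of [T] exists yet, and the
    messages sent here are its first ballots. *)
Lemma ballot_request crd prep tx net T c sn ws co ht :
  ballot_inv crd prep tx net -> tx T = Some (txn0 c sn) ->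
  let x := begin_commit (txn0 (S := S) c sn) ws co in
  ballot_inv crd prep (upd tx T (Some x))
    (send net (inS (crd T)) (prepare_messages x T ht)).
Proof.
move=> inv txT x.
have noT s e : e \in prep s -> e_tid e <> T.
  by move=> /(entry_txn inv)[y [ey cy _]] eT; move: ey; rewrite eT txT => -[yE];
    rewrite -yE in cy.
have memE m s y : m \in send net (inS (crd T)) (prepare_messages x T ht) (inS s) y ->
    m \in net (inS s) y \/ s = crd T /\ m \in prepare_messages x T ht y.
  by rewrite mem_send node_eq => /orP[|/andP[/eqP]]; [left|right].
split.
- move=> T1 s1 s1'; rewrite ballots_send (ballot_count inv) !node_eq.
  rewrite /prepare_messages /= /awaited updE (eq_sym T1).
  case: (eqVneq T T1) => [<-|TT1]; last first.
    by do 2!case: ifP => _ //=; rewrite ?(negPf TT1) ?muln0 ?addn0.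
  by rewrite txT is_cohort0 andbF; do 2!case: ifP => _ //=;
    rewrite ?eqxx ?muln0 ?addn0 ?muln1 //= ?andbT ?andbF.
- move=> T1 sn1 ht1 ups s1 s1' y /memE[mT|[_ /mem_prepare_messages[s [<-] [_ [-> _ _ ->]]]]].
    rewrite updE; case: eqP => [T1E|_ /(prepare_writes inv mT)//].
    by have := prepare_awaited inv mT; rewrite /awaited T1E txT is_cohort0 andbF.
  by rewrite updE eqxx => -[<-].
- move=> T1 pt s1 s1' /memE[|[_ /mem_prepare_messages[s _ [_]]]] //;
    exact: (prepared_entry inv).
- move=> s1 e eP; have [y [ey cy uy]] := entry_txn inv eP; exists y; split=> //.
  by rewrite updE; case: eqP => // /(noT _ _ eP).
- move=> s1 s1' e eP; rewrite count_send (entry_unasked inv) // add0n.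
  rewrite /prepare_messages /=; case: ifP => _ /=; last by rewrite muln0.
  by case: (eqVneq T (e_tid e)) => [/esym/(noT _ _ eP)[]|_]; rewrite ?addn0 muln0.
- move=> s1 s1' e pt eP /memE[|[_ /mem_prepare_messages[s _ [_]]]] //;
    exact: (entry_vote inv).
- move=> s1 e y pt eP; rewrite updE; case: eqP => [/(noT _ _ eP)//|_];
    exact: (entry_prop inv).
- move=> T1 y s1; rewrite updE; case: eqP => [_ [<-]//|_];
    exact: (open_entry inv).
- move=> T1 ct p q; rewrite mem_send => /orP[mT|/andP[_ /mem_prepare_messages[s _ [_]]]] //.
  have [y ey cy] := commit_txn inv mT; exists y => //.
  by rewrite updE; case: eqP => // eT; move: ey cy; rewrite eT txT => -[<-].
- move=> T1 y ct n; rewrite updE; case: eqP => [_ [<-]//|_];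
    exact: (prop_le_ct inv).
Qed.

Lemma ballot_prepare crd prep tx net s s' T sn ht ups ms pt :
  ballot_inv crd prep tx net ->
  net (inS s) (inS s') = MPrepare T sn ht ups :: ms ->
  ballot_inv crd (upd prep s' (Entry T pt ups :: prep s')) tx
    (send (dequeue net (inS s) (inS s')) (inS s') (to (inS s) (MPrepared S T pt))).
Proof.
move=> inv e0.
have m0 : MPrepare T sn ht ups \in net (inS s) (inS s') by rewrite e0 mem_head.
have aw := prepare_awaited inv m0.
have [x txT] : exists x, tx T = Some x by move: aw; rewrite /awaited;
  case: (tx T) => // x; exists x.
have [sE co px _] := awaited_open inv aw txT.
(* By [entry_unasked], a prepare message still in flight means that [s'] has no entry for [T]. *)
have noT e : e \in prep s' -> e_tid e <> T.
  move=> eP eT; have := entry_unasked inv s eP; rewrite eT.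
  by have := prepare_count m0; lia.
(* The prepare message at the head already uses up the single ballot of [s']. *)
have nopt pt1 s1 : MPrepared S T pt1 \notin net (inS s') (inS s1).
  apply/negP => m1; have aw1 := prepared_awaited inv m1.
  have [s1E _ _ _] := awaited_open inv aw1 txT.
  have := ballot_count inv T s s'; rewrite /ballots aw.
  by have := prepared_count m1; have := prepare_count m0; rewrite s1E sE; lia.
have memE m p q : m \in send (dequeue net (inS s) (inS s')) (inS s') (to (inS s)
  (MPrepared S T pt)) p q ->
    m \in net p q \/ [/\ p = inS s', q = inS s & m = MPrepared S T pt].
  rewrite mem_send mem_to => /orP[/mem_dequeue|/and3P[/eqP-> /eqP-> /eqP->]];
    by [left|right].
have prepE s1 e : e \in upd prep s' (Entry T pt ups :: prep s') s1 ->
    s1 = s' /\ e = Entry T pt ups \/ e \in prep s1.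
  rewrite updE; case: eqP => [->|_]; last by right.
  by rewrite inE => /orP[/eqP->|]; [left|right].
have prepS s1 e : e \in prep s1 -> e \in upd prep s' (Entry T pt ups :: prep s') s1.
  by rewrite updE; case: eqP => [->|//]; rewrite inE orbC => ->.
split.
- move=> T1 s1 s1'; rewrite -(ballot_count inv) ballots_send (ballots_dequeue _ _
    _ e0) !node_eq !count_to /=.
  by rewrite !node_eq !andbF !muln0 !addn0 (eq_sym s s1) (eq_sym s' s1') andbCA !mulnb.
- by move=> T1 sn1 ht1 ups1 s1 s1' y /memE[|[]] //; apply: (prepare_writes inv).
- move=> T1 pt1 s1 s1' /memE[/(prepared_entry inv)[e /prepS]|[[->] _ [-> _]]];
    first by exists e.
  by exists (Entry T pt ups) => //; rewrite updE eqxx mem_head.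
- move=> s1 e /prepE[[-> ->]|/(entry_txn inv)//]; exists x; split=> //=.
  exact: (prepare_writes inv m0).
- move=> s1 s1' e eP; rewrite count_send count_to /= muln0 muln0 addn0.
  have := count_dequeue (is_prepare (e_tid e)) (inS s1) (inS s1') e0.
  case/prepE: eP => [[-> ->]|/(entry_unasked inv s1) ->]; last by lia.
  have := ballot_count inv T s1 s'; rewrite /ballots /awaited txT !node_eq !eqxx /=.
  case: (eqVneq s1 (crd T)) => [->|_] /=; last by lia.
  by rewrite -sE eqxx co px /=; lia.
- move=> s1 s1' e pt1 /prepE[[-> ->]|eP] /memE[|[]] /=.
  + by move=> h; have := nopt pt1 s1; rewrite h.
  + by move=> _ _ [].
  + exact: (entry_vote inv).
  + by move=> [s1E] _ [eT]; rewrite s1E in eP; case: (noT _ eP).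
- move=> s1 e y pt1 /prepE[[-> ->]|eP] /=; last exact: (entry_prop inv).
  by rewrite txT => -[<-]; rewrite px.
- move=> T1 y s1 t1 c1 o1 p1; have [e /prepS eP eT] :=
    open_entry inv t1 c1 o1 p1; by exists e.
- by move=> T1 ct p q /memE[|[]] //; apply: (commit_txn inv).
- exact: (prop_le_ct inv).
Qed.

(** The entries of [T] may be dropped: [T] is decided, so neither [prepared_entry] nor [open_entry]
    asks for them any more. *)
Lemma ballot_commit crd prep tx net p s' T ct ms :
  ballot_inv crd prep tx net -> net p (inS s') = MCommit S T ct :: ms ->
  ballot_inv crd (upd prep s' [seq e <- prep s' | e_tid e != T]) tx
    (dequeue net p (inS s')).
Proof.
move=> inv e0.
have [x txT ctx] : exists2 x, tx T = Some x & tx_ct x = Some ct.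
  by apply: (commit_txn inv (p := p) (q := inS s')); rewrite e0 mem_head.
have prepS s1 e : e \in upd prep s' [seq e <- prep s' | e_tid e != T] s1 ->
  e \in prep s1.
  by rewrite updE; case: eqP => [->|//]; rewrite mem_filter => /andP[].
have prepT s1 e : e \in prep s1 -> e_tid e <> T ->
    e \in upd prep s' [seq e <- prep s' | e_tid e != T] s1.
  by move=> eP /eqP eT; rewrite updE; case: eqP => [s1E|//];
    rewrite mem_filter eT -s1E.
split.
- by move=> T1 s1 s1'; rewrite -(ballot_count inv) (ballots_dequeue _ _ _ e0) /= !andbF !addn0.
- move=> T1 sn1 ht1 ups1 s1 s1' y /mem_dequeue; exact: (prepare_writes inv).
- move=> T1 pt1 s1 s1' /mem_dequeue m1; have [e eP eT] := prepared_entry inv m1.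
  exists e => //; apply: prepT => // eT'; rewrite -eT eT' in m1.
  by have [_ _ _] := awaited_open inv (prepared_awaited inv m1) txT; rewrite ctx.
- by move=> s1 e /prepS /(entry_txn inv).
- move=> s1 s1' e /prepS /(entry_unasked inv s1).
  by rewrite (count_dequeue _ _ _ e0); lia.
- by move=> s1 s1' e pt /prepS eP /mem_dequeue; apply: (entry_vote inv).
- by move=> s1 e y pt /prepS; apply: (entry_prop inv).
- move=> T1 y s1 t1 c1 o1 p1; have [e eP eT] := open_entry inv t1 c1 o1 p1.
  exists e => //; apply: prepT => // eT'; move: t1; rewrite -eT eT' txT => -[yE].
  by rewrite yE o1 in ctx.
- by move=> T1 ct1 p1 q1 /mem_dequeue; apply: (commit_txn inv).
- exact: (prop_le_ct inv).
Qed.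

(** What [vote_kind] retains of [decision_messages]: the answer to the client is dropped. *)
Definition commit_messages (x : txn S) (T : tid) : node -> seq (msg S) :=
  to_servers (fun s =>
    if tx_ct x is Some ct then if is_cohort x s then [:: MCommit S T ct] else [::]
    else [::]).

Lemma mem_commit_messages x T y m : m \in commit_messages x T y ->
  exists2 ct, tx_ct x = Some ct & m = MCommit S T ct.
Proof.
case: y => // s; rewrite /commit_messages /=; case: (tx_ct x) => // ct.
by case: ifP => // _; rewrite inE => /eqP->; exists ct.
Qed.

Lemma count_commit_messages P x T y : (forall ct, ~~ P (MCommit S T ct)) ->
  count P (commit_messages x T y) = 0.
Proof.
move=> Pn; apply/eqP; rewrite -leqn0 leqNgt -has_count; apply/hasPn => m.
by case/mem_commit_messages => ct _ ->.
Qed.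

(** The delivered vote was awaited, so [x] is still undecided and a decision made here is its first.
    Each partition has one cohort ([is_cohort_inj]), so indexing proposals by partitions confuses no
    two voters. *)
Lemma ballot_prepared crd prep tx net s s' T pt ms x :
  ballot_inv crd prep tx net ->
  net (inS s') (inS s) = MPrepared S T pt :: ms -> tx T = Some x ->
  let x' := add_proposal x s'.1 pt in
  ballot_inv crd prep (upd tx T (Some x'))
    (send (dequeue net (inS s') (inS s)) (inS s) (commit_messages x' T)).
Proof.
move=> inv e0 txT x'.
have m0 : MPrepared S T pt \in net (inS s') (inS s) by rewrite e0 mem_head.
have aw := prepared_awaited inv m0.
have [sE co px ctx] := awaited_open inv aw txT.
have [e0' eP0 eT0] := prepared_entry inv m0.
have memE m p q : m \in send (dequeue net (inS s') (inS s)) (inS s) (commit_messages x' T) p q ->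
    m \in net p q \/ exists2 ct, tx_ct x' = Some ct & m = MCommit S T ct.
  by rewrite mem_send => /orP[/mem_dequeue|/andP[_ /mem_commit_messages]];
    [left|right].
have x'p n : tx_prop x' n = if n == s'.1 then Some pt else tx_prop x n by [].
split.
- move=> T1 s1 s1'; rewrite ballots_send.
  rewrite !count_commit_messages //.
  rewrite !muln0 !addn0.
  have := ballots_dequeue T1 s1 s1' e0; rewrite (ballot_count inv) /= !andbF addn0 !node_eq.
  rewrite /awaited updE (eq_sym T1).
  case: (eqVneq T T1) => [<-|_]; last by rewrite !andbF addn0 => ->.
  rewrite txT x'p -[is_cohort x' _]/(is_cohort x s1') -sE (eq_sym s1) andbT.
  case: (eqVneq s s1) => [_|_] /=; last by rewrite andbF; lia.
  case: (eqVneq s' s1') => [<-|ne] /=; first by rewrite co px eqxx /=; lia.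
  case co1: (is_cohort x s1') => /=; last by lia.
  case: eqP => [s1E|_]; last by lia.
  by rewrite (is_cohort_inj co1 co s1E) eqxx in ne.
- move=> T1 sn1 ht ups s1 s1' y /memE[mT|[?]] //.
  rewrite updE; case: eqP => [T1E|_]; last exact: (prepare_writes inv mT).
  move=> [<-]; rewrite T1E in mT; exact: (prepare_writes inv mT txT).
- by move=> T1 pt1 s1 s1' /memE[/(prepared_entry inv)|[?]].
- move=> s1 e /(entry_txn inv)[y [ey cy uy]]; rewrite updE; case: eqP => [eT|_];
    last by exists y.
  by move: ey; rewrite eT txT => -[yE]; subst y; exists x'.
- move=> s1 s1' e /(entry_unasked inv s1).
  have := count_dequeue (is_prepare (e_tid e)) (inS s1) (inS s1') e0.
  by rewrite count_send count_commit_messages // muln0; lia.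
- by move=> s1 s1' e pt1 eP /memE[|[?]] //; apply: (entry_vote inv).
- move=> s1 e y pt1 eP; rewrite updE; case: eqP => [eT|_];
    last exact: (entry_prop inv).
  move=> [<-]; rewrite x'p; case: eqP => [s1E [<-]|_].
    have [z [ez cz _]] := entry_txn inv eP.
    move: ez; rewrite eT txT => -[zE]; rewrite -zE in cz.
    by apply: (entry_vote inv (s := s) eP); rewrite eT (is_cohort_inj cz co s1E).
  by move=> h; apply: (entry_prop inv eP _ h); rewrite eT.
- move=> T1 y s1; rewrite updE; case: eqP => [->|_]; last exact: (open_entry inv).
  move=> [<-] co1 _; rewrite x'p; case: eqP => [s1E _|_].
    by rewrite (is_cohort_inj (x := x) co1 co s1E); exists e0'.
  exact: (open_entry inv txT co1 ctx).
- move=> T1 ct p q /memE[mT|[ct' ctE [-> ->]]]; last by exists x' => //;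
    rewrite updE eqxx.
  have [y ey cy] := commit_txn inv mT; exists y => //.
  by rewrite updE; case: eqP => // eT; move: ey cy; rewrite eT txT => -[<-];
    rewrite ctx.
- move=> T1 y ct n; rewrite updE; case: eqP => [_ [<-]|_];
    last exact: (prop_le_ct inv).
  rewrite {1}/x' /add_proposal /= /decision; case: ifP => // /forallP ap [<-] pn.
  have := implyP (ap n) pn; rewrite -[upd _ _ _ n]/(tx_prop x' n).
  case en: (tx_prop x' n) => [pt1|//] _; exists pt1 => //.
  (* The commit time is a maximum over the touched partitions; all of them have answered, so the
     default of [odflt] does not occur. *)
  have := leq_bigmax_cond (F := fun n => odflt 0 (tx_prop x' n)) n pn.
  by rewrite en.
Qed.

(** * Preservation of the commit invariants, and finality of decisions *)

Definition token_kind m : bool :=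
  match m with MStarted _ _ | MCommitReq _ _ _ => true | _ => false end.

Definition vote_kind m : bool :=
  match m with MPrepare _ _ _ _ | MPrepared _ _ | MCommit _ _ => true | _ =>
    false end.

Definition repl_kind m : bool :=
  match m with MReplicate _ _ | MHeartbeat _ => true | _ => false end.

Definition txn_inv (crd : tid -> server) st : Prop :=
  token_inv crd (fun c => held (st_cli st c)) (st_txn st)
    (restrict token_kind (st_net st)) /\
  ballot_inv crd (fun s => sv_prep (st_srv st s)) (st_txn st)
    (restrict vote_kind (st_net st)).

Lemma held_reading (x : client_state S) ks tn u h wc rs ws :
  cl_txn x = tn -> ~~ (if cl_status x is Committing then true else false) ->
  held (ClientState (reading ks) tn u h wc rs ws) = held x.
Proof. by case: x => [[||?|] ? ? ? ? ? ?] //= -> _; rewrite /held; case: ks. Qed.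

Lemma restrict_out_prepare x T ht :
  restrict_out vote_kind (prepare_messages (S :=
    S) x T ht) = prepare_messages x T ht.
Proof.
apply: functional_extensionality => -[c|s] //.
by rewrite /restrict_out /prepare_messages /=; case: ifP.
Qed.

Lemma restrict_out_decision x T :
  restrict_out vote_kind (decision_messages (S := S) x T) = commit_messages x T.
Proof.
apply: functional_extensionality => y.
rewrite /restrict_out /decision_messages /commit_messages.
case: (tx_ct x) => [ct|]; last by case: y.
by case: y => [c|s] /=; case: ifP.
Qed.

Lemma apply_messages_kind s (x : server_state S) clk m :
  m \in apply_messages s x clk -> repl_kind m.
Proof.
rewrite /apply_messages; case: (sv_comm x) => [|e es];
  first by rewrite inE => /eqP->.
by case/mapP => ct _ ->.
Qed.

Lemma filter_to_replicas0 k s ms y : all (fun m => ~~ k m) ms ->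
  filter k (to_replicas (S := S) s ms y) = [::].
Proof.
move=> h; case: y => // s'; rewrite /to_replicas /=; case: ifP => // _.
by apply/eqP; rewrite -[_ == _]negbK -has_filter -all_predC.
Qed.

Lemma txn_inv_frame crd st st' : txn_inv crd st ->
  (fun c => held (st_cli st' c)) = (fun c => held (st_cli st c)) ->
  (fun s => sv_prep (st_srv st' s)) = (fun s => sv_prep (st_srv st s)) ->
  st_txn st' = st_txn st ->
  (forall k, k = token_kind \/ k = vote_kind ->
     restrict k (st_net st') = restrict k (st_net st)) ->
  txn_inv crd st'.
Proof. by move=> [inv1 inv2] eh ep et en; split; rewrite ?eh ?ep et en; auto. Qed.

Lemma internal_txn_inv crd st st' :
  txn_inv crd st -> internal st st' -> txn_inv crd st'.
Proof.
move=> inv; case.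
- move=> c s rd _; apply: (txn_inv_frame inv) => //=.
    by apply: upd_proj; rewrite /held rd.
  by move=> k [] ->; apply: restrict_send0 => y; rewrite /to; case: eqP.
- move=> c T s ks rd _; apply: (txn_inv_frame inv) => //=.
    by apply: upd_proj; apply: held_reading; rewrite ?rd.
  move=> k [] ->; apply: restrict_send0 => y; case: (missing _ _) => // ? ?;
    by rewrite /to; case: eqP.
- by move=> c T s key v rd _; apply: (txn_inv_frame inv) => //=; apply: upd_proj.
- move=> c T s e ws rd txT _; case: inv => inv1 inv2; split => /=.
    rewrite (upd_map held) restrict_send restrict_out_to /=.
    by apply: token_commit => //; rewrite /held rd.
  by rewrite restrict_send0 // => y; rewrite /to; case: eqP.
- move=> s clk _; apply: (txn_inv_frame inv) => //=; first exact: upd_proj.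
  move=> k kE; apply: restrict_send0 => y; apply: filter_to_replicas0.
  by apply/allP => m /apply_messages_kind; case: kE => ->; case: m.
- by move=> s; apply: (txn_inv_frame inv).
- by move=> m vv g _ _; apply: (txn_inv_frame inv).
- by move=> s m g _; apply: (txn_inv_frame inv) => //=; apply: upd_proj.
- by move=> s u _; apply: (txn_inv_frame inv) => //=; apply: upd_proj.
Qed.

Lemma deliver_txn_inv crd st p q m ms st' :
  txn_inv crd st -> st_net st p q = m :: ms ->
  deliver p q m (set_net st (dequeue (st_net st) p q)) st' ->
  exists crd', txn_inv crd' st'.
Proof.
move=> inv netE; move E: (set_net _ _) => st0 dl.
have to0 k (out : node -> seq (msg S)) : ~~ k m ->
  (forall y, filter k (out y) = [::]) ->
    restrict k (send (dequeue (st_net st) p q) q out) = restrict k (st_net st).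
  by move=> km o0; rewrite restrict_send0 // (restrict_dequeue _ netE) (negPf km).
have dq0 k : ~~ k m -> restrict k (dequeue (st_net st) p q) = restrict k (st_net st).
  by move=> km; rewrite (restrict_dequeue _ netE) (negPf km).
case: dl E netE to0 dq0.
- move=> st1 c s u T txT x E netE to0 dq0; subst st1; exists (upd crd T s).
  case: inv => inv1 inv2; split; rewrite /= ?(upd_proj (h := @sv_prep S)) //.
    rewrite restrict_send (restrict_dequeue _ netE) restrict_out_to /=.
    exact: token_start.
  rewrite to0 => [|//|y]; last by rewrite /to; case: eqP.
  exact: ballot_start.
- move=> st1 c s T sn rd E netE to0 dq0; subst st1; exists crd.
  case: inv => inv1 inv2; split => /=; last by rewrite dq0.
  rewrite (upd_map held) (restrict_dequeue _ netE) /=.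
  by apply: token_started => //; apply: restrict_head netE _.
- move=> st1 c s T x ks pick txT E netE to0 dq0; subst st1; exists crd.
  apply: (txn_inv_frame inv) => //= k kE; apply: to0; first by case: kE => ->.
  move=> [|s'] //=; apply/eqP; rewrite -[_ == _]negbK -has_filter -all_predC.
  by apply/allP => m1 /mapP[key _ ->]; case: kE => ->.
- move=> st1 s s' T sn key o fr E netE to0 dq0; subst st1; exists crd.
  apply: (txn_inv_frame inv) => //=; first exact: upd_proj.
  move=> k kE; apply: to0; first by case: kE => ->.
  by move=> y; rewrite /to; case: eqP => //=; case: kE => ->.
- move=> st1 s s' T x key o txT E netE to0 dq0; subst st1; exists crd.
  apply: (txn_inv_frame inv) => //= k kE; apply: to0; first by case: kE => ->.
  by move=> y; rewrite /to; case: eqP => //=; case: kE => ->.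
- move=> st1 c s T key o ks rd E netE to0 dq0; subst st1; exists crd.
  apply: (txn_inv_frame inv) => //=.
    by apply: upd_proj; apply: held_reading; rewrite ?rd.
  by move=> k kE; apply: dq0; case: kE => ->.
- move=> st1 c s T x hwt ws co txT x' E netE to0 dq0; subst st1; exists crd.
  case: inv => inv1 inv2.
  have h := restrict_head (k := token_kind) netE isT.
  have [inv1' [crdT [sn xE]]] := token_commit_req inv1 h.
  split => /=; rewrite restrict_send (restrict_dequeue _ netE) /=.
    rewrite send0 //; move=> [|s1] //; rewrite /restrict_out /prepare_messages /=.
    by case: ifP.
  rewrite restrict_out_prepare -crdT /x'.
  by move: txT => /=; rewrite xE => -[<-]; apply: ballot_request.
- move=> st1 s s' T sn ht ups clk _ E netE to0 dq0; subst st1; exists crd.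
  case: inv => inv1 inv2; split => /=.
    by rewrite to0 // => y; rewrite /to; case: eqP.
  rewrite (upd_map (@sv_prep S)) restrict_send (restrict_dequeue _ netE) restrict_out_to /=.
  by apply: ballot_prepare => //; apply: restrict_head netE _.
- move=> st1 s s' T x pt txT x' E netE to0 dq0; subst st1; exists crd.
  have h := restrict_head (k := vote_kind) netE isT.
  case: inv => inv1 inv2; split => /=; last first.
    rewrite restrict_send (restrict_dequeue _ netE) restrict_out_decision /=.
    exact: ballot_prepared h txT.
  rewrite to0 //; last first.
    move=> [c|s1] /=; rewrite /decision_messages; case: (tx_ct x') => // ct;
      by case: ifP.
  (* A transaction with a token has a record [txn0], which has no cohorts, so it is not the one
     whose vote arrives. *)
  apply: (token_inv_le inv1) => // T1 c s1 /(token_txn inv1)[_ [sn T1E]].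
  rewrite updE; case: eqP => // eT; move: T1E; rewrite eT => T1E.
  have /(awaited_open inv2) : awaited crd (st_txn st) T s s'.
    by apply: (prepared_awaited (pt := pt) inv2); rewrite h mem_head.
  by move=> /(_ _ T1E)[].
- move=> st1 s s' T ct clk _ E netE to0 dq0; subst st1; exists crd.
  case: inv => inv1 inv2; split => /=; first by rewrite dq0.
  rewrite (upd_map (@sv_prep S)) (restrict_dequeue _ netE) /=.
  by apply: ballot_commit => //; apply: restrict_head netE _.
- move=> st1 c s T ct rd E netE to0 dq0; subst st1; exists crd.
  apply: (txn_inv_frame inv) => //=; first by apply: upd_proj; rewrite /held rd.
  by move=> k kE; apply: dq0; case: kE => ->.
- move=> st1 s s' ct ds E netE to0 dq0; subst st1; exists crd.
  apply: (txn_inv_frame inv) => //=; first exact: upd_proj.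
  by move=> k kE; apply: dq0; case: kE => ->.
- move=> st1 s s' t E netE to0 dq0; subst st1; exists crd.
  apply: (txn_inv_frame inv) => //=; first exact: upd_proj.
  by move=> k kE; apply: dq0; case: kE => ->.
Qed.

Lemma step_txn_inv crd st st' :
  txn_inv crd st -> step st st' -> exists crd', txn_inv crd' st'.
Proof.
move=> inv; case=> [st1 int|p q m ms st1]; last exact: (deliver_txn_inv inv).
by exists crd; apply: internal_txn_inv int.
Qed.

Lemma txn_inv0 crd : txn_inv crd (state0 S).
Proof. by split; split. Qed.

(** The entry carries the proposal recorded for its partition, and the commit time is the maximum of
    these. Version vectors depend on the commit protocol through this fact. *)
Lemma entry_le_ct crd st T ct p q s e : txn_inv crd st ->
  MCommit S T ct \in st_net st p q -> e \in sv_prep (st_srv st s) ->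
  e_tid e = T -> e_ts e <= ct.
Proof.
move=> [_ inv] mT eP eT.
have mT' : MCommit S T ct \in restrict vote_kind (st_net st) p q by rewrite mem_filter.
have [x txT ctx] := commit_txn inv mT'.
have [y [ty cy _]] := entry_txn inv eP.
move: ty; rewrite eT txT => -[xy]; rewrite -xy in cy.
case/andP: cy => px _; have [pt e1 le] := prop_le_ct inv txT ctx px.
by rewrite -(entry_prop inv eP _ e1) // eT.
Qed.

(** An existing record is rewritten only by a request, which needs a record [txn0], or by a vote,
    which must be awaited; a decided record meets neither condition. *)
Lemma step_decided crd st st' T x ct : txn_inv crd st -> step st st' ->
  st_txn st T = Some x -> tx_ct x = Some ct -> st_txn st' T = Some x.
Proof.
move=> [inv1 inv2] h txT ctx; case: h => [st1 []//|p q m ms st1 netE].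
move E: (set_net _ _) => st0 dl; case: dl E netE => //.
all: try by move=> *; subst.
- move=> st2 c s u T1 tx1 x1 E netE; subst st2; rewrite /= updE.
  by case: eqP => // eT; move: tx1 => /=; rewrite -eT txT.
- move=> st2 c s T1 y hwt ws co ty x' E netE; subst st2; rewrite /= updE.
  have h := restrict_head (k := token_kind) netE isT.
  have [_ [_ [sn xE]]] := token_commit_req inv1 h.
  by case: eqP => // eT; move: xE; rewrite -eT txT => -[yE]; rewrite yE in ctx.
- move=> st2 s s' T1 y pt ty x' E netE; subst st2; rewrite /= updE.
  have h := restrict_head (k := vote_kind) netE isT.
  case: eqP => // eT; rewrite -eT in h.
  have /(awaited_open inv2) : awaited crd (st_txn st) T s s'.
    by apply: (prepared_awaited (pt := pt) inv2); rewrite h mem_head.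
  by move=> /(_ _ txT)[_ _ _]; rewrite ctx.
Qed.

Lemma step_txn st st' T x : step st st' -> st_txn st T = Some x ->
  exists x', [/\ st_txn st' T = Some x', tx_sn x' = tx_sn x & tx_client x' = tx_client x].
Proof.
move=> h txT; case: h => [st1 [] *|p q m ms st1 netE]; try by exists x.
move E: (set_net _ _) => st0 dl; case: dl E netE.
all: try by move=> *; subst; exists x.
- move=> st2 c s u T1 tx1 x1 E netE; subst st2; rewrite /= updE.
  by case: eqP => [eT|_]; [move: tx1 => /=; rewrite -eT txT|exists x].
- move=> st2 c s T1 y hwt ws co ty x' E netE; subst st2; rewrite /= updE.
  case: eqP => [eT|_]; last by exists x.
  by exists x'; move: ty => /=; rewrite -eT txT => -[->].
- move=> st2 s s' T1 y pt ty x' E netE; subst st2; rewrite /= updE.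
  case: eqP => [eT|_]; last by exists x.
  by exists x'; move: ty => /=; rewrite -eT txT => -[->].
Qed.

(** * Version vectors *)

(* The own entry of the version vector stays below every timestamp that the
   server still has to install, including those it has not proposed yet.  A
   proposal can exceed the HLC, which does not follow the UST; this is why the
   third field is only stated for an empty [sv_prep]. *)
Record local_inv (x : server_state S) (r : 'I_(nreps S)) : Prop := LocalInv {
  vv_lt_prep : forall e, e \in sv_prep x -> sv_vv x r < e_ts e;
  vv_lt_comm : forall e, e \in sv_comm x -> sv_vv x r < e_ts e;
  vv_lt_next : sv_prep x = [::] -> sv_vv x r < maxn (sv_clock x) (sv_hlc x).+1;
  prep_le_hlc : forall e, e \in sv_prep x -> e_ts e <= maxn (sv_hlc x) (sv_ust x)
}.

Lemma foldr_minn_le a l b : b \in a :: l -> foldr minn a l <= b.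
Proof.
elim: l b => [|c l IH] b; first by rewrite inE => /eqP->.
rewrite !inE /= geq_min => /or3P[bE|/eqP->|bE]; rewrite ?leqnn //.
  by rewrite IH ?orbT // inE bE.
by rewrite IH ?orbT // inE bE orbT.
Qed.

Lemma foldr_minn_mem a l : foldr minn a l \in a :: l.
Proof.
elim: l => [|c l IH] /=; first by rewrite mem_head.
rewrite {1}/minn; case: ifP => _; first by rewrite !inE eqxx orbT.
by move: IH; rewrite !inE => /orP[]->; rewrite ?orbT.
Qed.

Lemma upper_bound_lt_prep (x : server_state S) r clk e : local_inv x r ->
  e \in sv_prep x -> upper_bound x clk < e_ts e.
Proof.
(* This makes [e_ts e] positive; otherwise the predecessor in [upper_bound], which is 0 at 0, could
   equal it. *)
move=> inv eP; have := vv_lt_prep inv eP.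
rewrite /upper_bound; case: (sv_prep x) eP => // e0 es eP.
have : e_ts e \in e_ts e0 :: map (@e_ts S) es by apply: (map_f (@e_ts S) eP).
by move=> /foldr_minn_le; lia.
Qed.

Lemma upper_bound_ge (x : server_state S) r clk : local_inv x r ->
  sv_clock x <= clk -> sv_vv x r <= upper_bound x clk.
Proof.
move=> inv lec; rewrite /upper_bound; case e: (sv_prep x) => [|e0 es].
  by have := vv_lt_next inv e; lia.
have /mapP[e1 e1P ->] : foldr minn (e_ts e0) (map (@e_ts S) es) \in map (@e_ts S) (sv_prep x).
  by rewrite e foldr_minn_mem.
by have := vv_lt_prep inv e1P; lia.
Qed.

Lemma local_raise_ust x r u : local_inv x r -> local_inv (raise_ust x u) r.
Proof. by case=> h1 h2 h3 h4; split=> //= e /h4; lia. Qed.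

Lemma local_receive_gst x r i g : local_inv x r ->
  local_inv (receive_gst x i g) r.
Proof. by case=> h1 h2 h3 h4; split. Qed.

Lemma local_replicate x r i t ds : i != r -> local_inv x r ->
  local_inv (replicate x i t ds) r.
Proof.
by move=> ir [h1 h2 h3 h4]; split=> //= *; rewrite ffunE eq_sym (negPf ir); auto.
Qed.

(** If nothing is prepared, [vv_lt_next] puts the own entry below the new proposal. Otherwise any
    older entry does: its timestamp exceeds the own entry and is at most
    [maxn (sv_hlc x) (sv_ust x)], hence at most the proposal. *)
Lemma local_prepare x r clk T sn ht ups : sv_clock x <= clk -> local_inv x r ->
  local_inv (prepare x clk T sn ht ups) r.
Proof.
move=> lec inv; case: (inv) => h1 h2 h3 h4; split=> //= e.
  rewrite inE => /orP[/eqP->|/h1//] /=; rewrite /proposal /prepare_hlc.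
  case e0: (sv_prep x) => [|e1 es]; first by have := h3 e0; lia.
  have e1P : e1 \in sv_prep x by rewrite e0 mem_head.
  by have := h1 _ e1P; have := h4 _ e1P; lia.
rewrite inE /proposal /prepare_hlc => /orP[/eqP->|/h4] /=; lia.
Qed.

Lemma local_commit x r clk T ct : sv_clock x <= clk -> local_inv x r ->
  (forall e, e \in sv_prep x -> e_tid e = T -> e_ts e <= ct) ->
  local_inv (commit x clk T ct) r.
Proof.
move=> lec [h1 h2 h3 h4] le_ct; split=> /= [e|e||e].
- by rewrite mem_filter => /andP[_ /h1].
- rewrite mem_cat => /orP[/mapP[e']|/h2//].
  rewrite mem_filter => /andP[/eqP eT eP] -> /=.
  by have := h1 _ eP; have := le_ct _ eP eT; lia.
- case e0: (sv_prep x) => [|e1 es]; first by have := h3 e0; lia.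
  have e1P : e1 \in sv_prep x by rewrite e0 mem_head.
  (* The list can become empty only if [e1] itself is committed; its timestamp is then at most [ct],
     hence at most the new HLC. *)
  rewrite /=; case: (eqVneq (e_tid e1) T) => //= eT _.
  by have := h1 _ e1P; have := le_ct _ e1P eT; lia.
- by rewrite mem_filter => /andP[_ /h4]; lia.
Qed.

Lemma local_apply s x clk : sv_clock x <= clk -> local_inv x s.2 ->
  local_inv (apply_updates s x clk) s.2.
Proof.
move=> lec inv; split=> /= [e|e||e]; rewrite ?ffunE ?eqxx.
- exact: upper_bound_lt_prep inv.
- by rewrite mem_filter => /andP[].
- by rewrite /upper_bound /apply_clock => ->; lia.
- exact: (prep_le_hlc inv).
Qed.

(** * Replication channels and the version vector entries they feed *)

(** Strict for updates, because an entry that has reached [ct] must mean that no update of time [ct]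
    is still to come; a heartbeat may repeat an earlier bound. *)
Definition fits (lo : nat) m : bool :=
  match m with MReplicate ct _ => lo < ct | MHeartbeat t => lo <= t | _ =>
    true end.

Definition raised (lo : nat) m : nat :=
  match m with MReplicate ct _ => ct | MHeartbeat t => t | _ => lo end.

(* Delivering [ms] to a server whose entry for the sender is [lo] raises it step
   by step, up to at most [hi]. *)
Fixpoint chan_ok (lo : nat) (ms : seq (msg S)) (hi : nat) : bool :=
  if ms is m :: ms' then fits lo m && chan_ok (raised lo m) ms' hi else lo <= hi.

Lemma raised_ge lo m : fits lo m -> lo <= raised lo m.
Proof. by case: m => //= ct _ /ltnW. Qed.

Lemma chan_ok_lower lo lo' ms hi : lo' <= lo -> chan_ok lo ms hi ->
  chan_ok lo' ms hi.
Proof.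
elim: ms lo lo' => [|m ms IH] lo lo' le /=; first exact: leq_trans.
case/andP=> fit ok; apply/andP; split.
  by case: m fit {ok} => //= [ct _|t]; apply: leq_trans.
by apply: IH ok; case: m {fit}.
Qed.

Lemma chan_ok_cat lo ms mid ms' hi :
  chan_ok lo ms mid -> chan_ok mid ms' hi -> chan_ok lo (ms ++ ms') hi.
Proof.
elim: ms lo => [|m ms IH] lo /=; first exact: chan_ok_lower.
by case/andP=> -> /= /IH h /h.
Qed.

Lemma chan_ok_le lo ms hi : chan_ok lo ms hi -> lo <= hi.
Proof.
elim: ms lo => //= m ms IH lo /andP[/raised_ge le /IH]; exact: leq_trans.
Qed.

Lemma chan_ok_replicate lo ms hi ct ds :
  chan_ok lo ms hi -> MReplicate ct ds \in ms -> lo < ct.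
Proof.
elim: ms lo => //= m ms IH lo /andP[fit ok];
  rewrite inE => /orP[/eqP mE|/(IH _ ok)].
  by rewrite -mE in fit.
exact: leq_ltn_trans (raised_ge fit).
Qed.

Lemma group_times_mem (x : server_state S) ub ct :
  (ct \in group_times x ub) = (ct <= ub) && (ct \in map (@e_ts S) (sv_comm x)).
Proof.
rewrite /group_times mem_sort mem_undup; apply/mapP/andP =>
  [[e]|[le /mapP[e eC eE]]].
  by rewrite mem_filter => /andP[le eC] ->; rewrite le map_f.
by exists e => //; rewrite mem_filter -eE le.
Qed.

(** [undup] makes the order strict, as [fits] demands of successive [MReplicate] messages. *)
Lemma group_times_sorted (x : server_state S) ub : sorted ltn (group_times x ub).
Proof. by rewrite ltn_sorted_uniq_leq sort_uniq undup_uniq sort_sorted //;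
  apply: leq_total. Qed.

Lemma chan_ok_groups g lo cts hi : sorted ltn cts ->
  all (fun ct => lo < ct) cts -> all (fun ct => ct <= hi) cts -> lo <= hi ->
  chan_ok lo [seq MReplicate ct (g ct) | ct <- cts] hi.
Proof.
elim: cts lo => //= ct cts IH lo srt /andP[-> _] /andP[le all_le] _ /=.
apply: IH => //; first exact: path_sorted srt.
by apply: order_path_min srt; apply: ltn_trans.
Qed.

(** When updates are pending, the upper bound itself is not transmitted, so the last message may lie
    below it; [chan_ok] allows this gap at its end. *)
Lemma chan_ok_apply s x clk : sv_clock x <= clk -> local_inv x s.2 ->
  chan_ok (sv_vv x s.2) (apply_messages s x clk) (upper_bound x clk).
Proof.
move=> lec inv; have le := upper_bound_ge inv lec.
rewrite /apply_messages; case e: (sv_comm x) => [|e1 es];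
  first by rewrite /= le /=.
apply: chan_ok_groups => //; first exact: group_times_sorted.
  by apply/allP => ct; rewrite group_times_mem =>
    /andP[_ /mapP[e' /(vv_lt_comm inv) h ->]].
by apply/allP => ct; rewrite group_times_mem => /andP[].
Qed.

Definition peer (s s' : server) : bool := (s'.1 == s.1) && (s'.2 != s.2).

(** [chan_peer] keeps a received message from changing the receiver's own entry, which [local_inv]
    governs; it also makes [chan_order] trivial for [s' = s]. *)
Record chan_inv (vv : server -> vvec S) net : Prop := ChanInv {
  chan_order : forall s s', s.1 = s'.1 ->
    chan_ok (vv s' s.2) (net (inS s) (inS s')) (vv s s.2);
  chan_peer : forall s s', ~~ peer s s' -> net (inS s) (inS s') = [::]
}.

Definition vv_inv st : Prop :=
  (forall s, local_inv (st_srv st s) s.2) /\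
  chan_inv (fun s => sv_vv (st_srv st s)) (restrict repl_kind (st_net st)).

Lemma server_eq (s s' : server) : s.1 = s'.1 -> s.2 = s'.2 -> s = s'.
Proof. by case: s s' => ? ? [? ?] /= -> ->. Qed.

Lemma chan_apply vv net s ms ub : chan_inv vv net ->
  chan_ok (vv s s.2) ms ub ->
  chan_inv (upd vv s (set_vv (vv s) s.2 ub)) (send net (inS s) (to_replicas s ms)).
Proof.
move=> [ord pr] ok; split=> s1 s2; last first.
  move=> np; rewrite sendE node_eq pr //=; case: eqP => // s1s.
  by rewrite /to_replicas /= -s1s -[_ && _]/(peer s1 s2) (negPf np).
move=> e12; rewrite sendE node_eq !updE.
case: (eqVneq s1 s) => [s1s|s1s]; case: (eqVneq s2 s) => [s2s|s2s].
- by subst s1 s2; rewrite /to_replicas /= !eqxx /= cats0 pr /peer ?ffunE ?eqxx //=.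
- subst s1; rewrite /to_replicas /= -e12 eqxx ffunE eqxx /=.
  case: eqP => [e|_] /=; last exact: chan_ok_cat (ord _ _ e12) ok.
  by case/eqP: s2s; apply: server_eq.
- subst s2; rewrite cats0 ffunE; case: eqP => [e|_]; last exact: ord.
  by case/eqP: s1s; apply: server_eq.
- by rewrite cats0; apply: ord.
Qed.

Lemma chan_receive vv net s s' m ms t : chan_inv vv net ->
  net (inS s) (inS s') = m :: ms ->
  (m = MHeartbeat S t \/ exists ds, m = MReplicate t ds) ->
  [/\ peer s s', vv s' s.2 <= t &
      chan_inv (upd vv s' (set_vv (vv s') s.2 t)) (dequeue net (inS s) (inS s'))].
Proof.
move=> [ord pr] e0 mE.
have p12 : peer s s' by apply/negPn/negP => /pr; rewrite e0.
case/andP: (p12) => /eqP ss1 ss2.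
have := ord s s' (esym ss1); rewrite e0 => ok0.
have [ok le] : chan_ok t ms (vv s s.2) /\ vv s' s.2 <= t.
  by case: mE ok0 => [->|[ds ->]] /= /andP[h ok]; split=> //; apply: ltnW.
split=> //; split=> s1 s2; last first.
  by move=> np; rewrite /dequeue pr //; case: ifP.
move=> e12; rewrite /dequeue !node_eq !updE.
(* The receiver changes its entry for [s] and not its own, so the upper ends of its outgoing
   channels stay fixed. *)
have hi : (if s1 == s' then set_vv (vv s') s.2 t else vv s1) s1.2 = vv s1 s1.2.
  by case: (eqVneq s1 s') => // ->; rewrite ffunE (negPf ss2).
rewrite hi; case: (eqVneq s2 s') => [s2E|_]; last by rewrite andbF; apply: ord.
subst s2; rewrite ffunE; case: (eqVneq s1 s) => [->|ne]; first by rewrite eqxx e0.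
case: eqP => [e|_]; last exact: ord.
by case/eqP: ne; apply: server_eq => //; rewrite e12.
Qed.

Definition vv_le st st' : Prop :=
  forall s i, sv_vv (st_srv st s) i <= sv_vv (st_srv st' s) i.

Lemma vv_inv_frame st st' : vv_inv st ->
  (forall s, local_inv (st_srv st' s) s.2) ->
  (fun s => sv_vv (st_srv st' s)) = (fun s => sv_vv (st_srv st s)) ->
  restrict repl_kind (st_net st') = restrict repl_kind (st_net st) ->
  vv_inv st' /\ vv_le st st'.
Proof.
move=> [loc ch] loc' ev en; split; first by split; rewrite ?ev ?en.
by move=> s i; rewrite -[sv_vv (st_srv st' s)]/((fun s =>
  sv_vv (st_srv st' s)) s) ev.
Qed.

Lemma internal_vv_inv st st' :
  vv_inv st -> internal st st' -> vv_inv st' /\ vv_le st st'.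
Proof.
move=> inv; case: (inv) => loc ch; case.
- move=> c s _ _; apply: (vv_inv_frame inv) => //=.
  by apply: restrict_send0 => y; rewrite /to; case: eqP.
- move=> c T s ks _ _; apply: (vv_inv_frame inv) => //=.
  by apply: restrict_send0 => y; case: (missing _ _) => // ? ?; rewrite /to;
    case: eqP.
- by move=> c T s key v rd _; apply: (vv_inv_frame inv).
- move=> c T s e ws rd txT _; apply: (vv_inv_frame inv) => //=.
  by apply: restrict_send0 => y; rewrite /to; case: eqP.
- move=> s clk lec; have locs := loc s; split; last first.
    move=> s1 i /=; rewrite updE; case: eqP => // ->; rewrite /= ffunE.
    by case: eqP => // ->; apply: upper_bound_ge.
  split=> /= [s1|]; first by rewrite updE; case: eqP => // ->; apply: local_apply.
  rewrite (upd_map (@sv_vv S)) restrict_send /=.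
  have -> : restrict_out repl_kind (to_replicas s (apply_messages s (st_srv st s) clk))
          = to_replicas s (apply_messages s (st_srv st s) clk).
    apply: functional_extensionality => -[c|s'] //.
    rewrite /restrict_out /to_replicas /=; case: ifP => // _.
    by apply/all_filterP/allP => m /apply_messages_kind; case: m.
  by apply: chan_apply => //; apply: chan_ok_apply.
- by move=> s; apply: (vv_inv_frame inv).
- by move=> m vv g _ _; apply: (vv_inv_frame inv).
- move=> s m g _; apply: (vv_inv_frame inv) => //=; last exact: upd_proj.
  by move=> s1; rewrite updE; case: eqP => // ->; apply: local_receive_gst.
- move=> s u _; apply: (vv_inv_frame inv) => //=; last exact: upd_proj.
  by move=> s1; rewrite updE; case: eqP => // ->; apply: local_raise_ust;
    apply: loc.
Qed.

Lemma deliver_vv_inv crd st p q m ms st' :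
  txn_inv crd st -> vv_inv st -> st_net st p q = m :: ms ->
  deliver p q m (set_net st (dequeue (st_net st) p q)) st' ->
  vv_inv st' /\ vv_le st st'.
Proof.
move=> tinv inv netE; case: (inv) => loc ch; move E: (set_net _ _) => st0 dl.
have to0 (out : node -> seq (msg S)) : ~~ repl_kind m ->
  (forall y, filter repl_kind (out y) = [::]) ->
    restrict repl_kind (send (dequeue (st_net st) p q) q out) = restrict repl_kind (st_net st).
  by move=> km o0; rewrite restrict_send0 // (restrict_dequeue _ netE) (negPf km).
have dq0 : ~~ repl_kind m -> restrict repl_kind (dequeue (st_net st) p q) =
  restrict repl_kind (st_net st).
  by move=> km; rewrite (restrict_dequeue _ netE) (negPf km).
case: dl E netE to0 dq0.
- move=> st1 c s u T txT x E netE to0 dq0; subst st1.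
  apply: (vv_inv_frame inv) => /=; last by apply: to0 => // y; rewrite /to;
    case: eqP.
    by move=> s1; rewrite updE; case: eqP => // ->; apply: local_raise_ust;
      apply: loc.
  exact: upd_proj.
- by move=> st1 c s T sn rd E netE to0 dq0; subst st1;
    apply: (vv_inv_frame inv) => //=; apply: dq0.
- move=> st1 c s T x ks pick txT E netE to0 dq0; subst st1.
  apply: (vv_inv_frame inv) => //=; apply: to0 => //.
  move=> [|s'] //=; apply/eqP; rewrite -[_ == _]negbK -has_filter -all_predC.
  by apply/allP => m1 /mapP[key _ ->].
- move=> st1 s s' T sn key o fr E netE to0 dq0; subst st1.
  apply: (vv_inv_frame inv) => /=; last by apply: to0 => // y; rewrite /to;
    case: eqP.
    by move=> s1; rewrite updE; case: eqP => // ->; apply: local_raise_ust;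
      apply: loc.
  exact: upd_proj.
- move=> st1 s s' T x key o txT E netE to0 dq0; subst st1.
  by apply: (vv_inv_frame inv) => //=; apply: to0 => // y; rewrite /to; case: eqP.
- by move=> st1 c s T key o ks rd E netE to0 dq0; subst st1;
    apply: (vv_inv_frame inv) => //=; apply: dq0.
- move=> st1 c s T x hwt ws co txT x' E netE to0 dq0; subst st1.
  apply: (vv_inv_frame inv) => //=; apply: to0 => // -[|s1] //=.
  by rewrite /prepare_messages /=; case: ifP.
- move=> st1 s s' T sn ht ups clk lec E netE to0 dq0; subst st1.
  apply: (vv_inv_frame inv) => /=; last by apply: to0 => // y; rewrite /to;
    case: eqP.
    by move=> s1; rewrite updE; case: eqP => // ->; apply: local_prepare => //;
      apply: loc.
  exact: upd_proj.
- move=> st1 s s' T x pt txT x' E netE to0 dq0; subst st1.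
  apply: (vv_inv_frame inv) => //=; apply: to0 => // y.
  by rewrite /decision_messages; case: (tx_ct x') => // ct; case: y => [c|s1];
    case: ifP.
- move=> st1 s s' T ct clk lec E netE to0 dq0; subst st1.
  apply: (vv_inv_frame inv) => /=; last exact: dq0.
    move=> s1; rewrite updE; case: eqP => // ->; apply: local_commit => // e eP.
    by apply: (entry_le_ct (p := inS s) (q := inS s') tinv _ eP);
      rewrite netE mem_head.
  exact: upd_proj.
- by move=> st1 c s T ct rd E netE to0 dq0; subst st1;
    apply: (vv_inv_frame inv) => //=; apply: dq0.
- move=> st1 s s' ct ds E netE _ _; subst st1.
  have h := restrict_head (k := repl_kind) netE isT.
  have [/andP[_ ne] le ch'] := chan_receive ch h (or_intror (ex_intro _ ds erefl)).
  split; last first.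
    by move=> s1 i /=; rewrite updE; case: eqP => // ->; rewrite /= ffunE;
      case: eqP => // ->.
  split=> /= [s1|]; last by rewrite (upd_map (@sv_vv S)) (restrict_dequeue _ netE).
  by rewrite updE; case: eqP => // ->; apply: local_replicate; rewrite // eq_sym.
- move=> st1 s s' t E netE _ _; subst st1.
  have h := restrict_head (k := repl_kind) netE isT.
  have [/andP[_ ne] le ch'] := chan_receive ch h (or_introl erefl).
  split; last first.
    by move=> s1 i /=; rewrite updE; case: eqP => // ->; rewrite /= ffunE;
      case: eqP => // ->.
  split=> /= [s1|]; last by rewrite (upd_map (@sv_vv S)) (restrict_dequeue _ netE).
  by rewrite updE; case: eqP => // ->; apply: local_replicate; rewrite // eq_sym.
Qed.

Lemma step_vv_inv crd st st' : txn_inv crd st -> vv_inv st -> step st st' ->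
  vv_inv st' /\ vv_le st st'.
Proof.
move=> tinv inv; case=> [st1 int|p q m ms st1]; first exact: internal_vv_inv int.
exact: (deliver_vv_inv tinv inv).
Qed.

Lemma vv_inv0 : vv_inv (state0 S).
Proof.
split=> [s|]; first by split=> //= _; rewrite ffunE.
by split=> //= s s' _; rewrite !ffunE.
Qed.

(** * Snapshot timestamps *)

Definition stable st (u : nat) : Prop := forall s i, u <= sv_vv (st_srv st s) i.

(** The guarantee given by a GST; a minimum over all data centers turns such bounds into a [stable]
    one. *)
Definition dc_stable st (d : 'I_(ndcs S)) (g : nat) : Prop :=
  forall s i, dc s = d -> g <= sv_vv (st_srv st s) i.

Definition snapshot_of m : option nat :=
  match m with
  | MStart u | MStarted _ u | MReadSlice _ u _ | MPrepare _ u _ _ => Some u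
  | _ => None
  end.

(** The fields cover every place where a snapshot timestamp can originate or be stored: a UST may be
    raised by a client, a read, a prepare message or stabilization. *)
Record snap_inv st : Prop := SnapInv {
  ust_stable : forall s, stable st (sv_ust (st_srv st s));
  client_stable : forall c, stable st (cl_ust (st_cli st c));
  txn_stable : forall T x, st_txn st T = Some x -> stable st (tx_sn x);
  msg_stable : forall p q m u, m \in st_net st p q -> snapshot_of m = Some u ->
    stable st u;
  report_le : forall s vv i, vv \in st_vvs st s -> vv i <= sv_vv (st_srv st s) i;
  gst_stable : forall d g, g \in st_gsts st d -> dc_stable st d g;
  known_gst_stable : forall s d, dc_stable st d (sv_gst (st_srv st s) d)
}.

Lemma stable_le st st' u : vv_le st st' -> stable st u -> stable st' u.
Proof. by move=> le h s i; apply: leq_trans (h s i) (le s i). Qed.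

Lemma dc_stable_le st st' d g : vv_le st st' -> dc_stable st d g ->
  dc_stable st' d g.
Proof. by move=> le h s i sd; apply: leq_trans (h s i sd) (le s i). Qed.

Lemma stable_max st u v : stable st u -> stable st v -> stable st (maxn u v).
Proof. by move=> hu hv s i; rewrite geq_max hu hv. Qed.

Lemma upd_all (A : eqType) (B : Type) (P : A -> B -> Prop) (f : A -> B) a b :
  (forall x, P x (f x)) -> P a b -> forall x, P x (upd f a b x).
Proof. by move=> h hb x; rewrite updE; case: eqP => // ->. Qed.

(** The new timestamps are compared with the version vectors before the step, and [vv_le] transports
    the bounds, so the cases need not examine how the step changes the vectors. *)
Lemma snap_inv_step st st' : vv_le st st' ->
  (forall s, stable st (sv_ust (st_srv st' s))) ->
  (forall c, stable st (cl_ust (st_cli st' c))) ->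
  (forall T x, st_txn st' T = Some x -> stable st (tx_sn x)) ->
  (forall p q m u, m \in st_net st' p q -> snapshot_of m = Some u ->
    stable st u) ->
  (forall s vv i, vv \in st_vvs st' s -> vv i <= sv_vv (st_srv st s) i) ->
  (forall d g, g \in st_gsts st' d -> dc_stable st d g) ->
  (forall s d, dc_stable st d (sv_gst (st_srv st' s) d)) ->
  snap_inv st'.
Proof.
move=> le h1 h2 h3 h4 h5 h6 h7; split.
- by move=> s; apply: stable_le le _.
- by move=> c; apply: stable_le le _.
- by move=> T x /h3; apply: stable_le.
- by move=> p q m u /h4 h /h; apply: stable_le.
- by move=> s vv i /h5 h; apply: leq_trans (h _) (le _ _).
- by move=> d g /h6; apply: dc_stable_le.
- by move=> s d; apply: dc_stable_le le _.
Qed.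

Lemma ust_upd st s x : (forall s, stable st (sv_ust (st_srv st s))) ->
  stable st (sv_ust x) -> forall s1, stable st (sv_ust (upd (st_srv st) s x s1)).
Proof. by move=> h xok; apply: (upd_all (P := fun _ x => stable st (sv_ust x))).
  Qed.

Lemma cli_upd st c x : (forall c, stable st (cl_ust (st_cli st c))) ->
  stable st (cl_ust x) -> forall c1, stable st (cl_ust (upd (st_cli st) c x c1)).
Proof. by move=> h xok; apply: (upd_all (P := fun _ x => stable st (cl_ust x))).
  Qed.

Lemma gst_upd st s x : (forall s d, dc_stable st d (sv_gst (st_srv st s) d)) ->
  sv_gst x = sv_gst (st_srv st s) ->
  forall s1 d, dc_stable st d (sv_gst (upd (st_srv st) s x s1) d).
Proof.
move=> h xE; apply: (upd_all (P := fun _ x => forall d,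
  dc_stable st d (sv_gst x d))) => // d.
by rewrite xE; apply: h.
Qed.

Lemma internal_snap_inv st st' : snap_inv st -> vv_le st st' ->
  internal st st' -> snap_inv st'.
Proof.
move=> inv le int; case: (inv) => h1 h2 h3 h4 h5 h6 h7.
have out_ok p out :
    (forall q m u, m \in out q -> snapshot_of m = Some u -> stable st u) ->
    forall p' q m u, m \in send (st_net st) p out p' q ->
      snapshot_of m = Some u -> stable st u.
  move=> ok p' q m u; rewrite mem_send => /orP[/h4|/andP[_ /ok]]; exact.
have to_ok q0 m0 : (forall u, snapshot_of m0 = Some u -> stable st u) ->
    forall q m u, m \in to q0 m0 q -> snapshot_of m = Some u -> stable st u.
  by move=> ok q m u; rewrite mem_to => /andP[_ /eqP->]; apply: ok.
case: int le.
- move=> c s _ _ le; apply: (snap_inv_step le) => //=;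
    first by apply: cli_upd => //=; apply: h2.
  by apply/out_ok/to_ok => u [<-]; apply: h2.
- move=> c T s ks _ _ le; apply: (snap_inv_step le) => //=;
    first by apply: cli_upd => //=; apply: h2.
  by apply: out_ok; case: (missing _ _) => // key ks'; apply: to_ok.
- by move=> c T s key v _ _ le; apply: (snap_inv_step le) => //=;
    apply: cli_upd => //=; apply: h2.
- move=> c T s e ws _ _ _ le; apply: (snap_inv_step le) => //=;
    first by apply: cli_upd => //=; apply: h2.
  exact/out_ok/to_ok.
- move=> s clk _ le; apply: (snap_inv_step le) => //=.
  + by apply: ust_upd => //=; apply: h1.
  + apply: out_ok => -[|s'] m u //; rewrite /to_replicas /=; case: ifP => // _.
    by move=> /apply_messages_kind; case: m.
  + exact: gst_upd.
- move=> s le; apply: (snap_inv_step le) => //= s1 vv i.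
  by rewrite updE; case: eqP => [->|_ /h5//]; rewrite inE => /orP[/eqP->|/h5].
- move=> d vv g vvP [_ gmin] le; apply: (snap_inv_step le) => //= d1 g1.
  rewrite updE; case: eqP => [->|_ /h6//];
    rewrite inE => /orP[/eqP->|/h6//] s i sd.
  apply: leq_trans (h5 _ _ i (vvP s sd)).
  by apply: (gmin (s, i)); rewrite /= sd.
- move=> s d g gP le; apply: (snap_inv_step le) => //=.
    by apply: ust_upd => //=; apply: h1.
  apply: (upd_all (P := fun _ x => forall d, dc_stable st d (sv_gst x d))) =>
    //= d1.
  by rewrite updE; case: eqP => [->|_]; [apply: h6|apply: h7].
- move=> s u [_ umin] le; apply: (snap_inv_step le) => //=.
    apply: ust_upd => //=; apply: stable_max; first exact: h1.
    (* Each server [s1] is covered by the GST of its own data center, which takes part in the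
       minimum. *)
    by move=> s1 i; apply: leq_trans (umin (dc s1) _) (h7 s (dc s1) s1 i _).
  exact: gst_upd.
Qed.

Lemma deliver_snap_inv st p q m ms st' : snap_inv st -> vv_le st st' ->
  st_net st p q = m :: ms ->
  deliver p q m (set_net st (dequeue (st_net st) p q)) st' -> snap_inv st'.
Proof.
move=> inv le netE; case: (inv) => h1 h2 h3 h4 h5 h6 h7;
  move E: (set_net _ _) => st0 dl.
have hm u : snapshot_of m = Some u -> stable st u.
  by apply: (h4 p q); rewrite netE mem_head.
have dq_ok p' q' m0 u : m0 \in dequeue (st_net st) p q p' q' ->
  snapshot_of m0 = Some u -> stable st u.
  by move=> /mem_dequeue/h4; exact.
have out_ok out :
    (forall q' m0 u, m0 \in out q' -> snapshot_of m0 = Some u -> stable st u) ->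
    forall p' q' m0 u, m0 \in send (dequeue (st_net st) p q) q out p' q' ->
    snapshot_of m0 = Some u -> stable st u.
  move=> ok p' q' m0 u; rewrite mem_send => /orP[/dq_ok|/andP[_ /ok]]; exact.
have to_ok q0 m0 : (forall u, snapshot_of m0 = Some u -> stable st u) ->
    forall q' m1 u, m1 \in to q0 m0 q' -> snapshot_of m1 = Some u -> stable st u.
  by move=> ok q' m1 u; rewrite mem_to => /andP[_ /eqP->]; apply: ok.
have ust_ok s x := @ust_upd st s x h1.
have cli_ok c x := @cli_upd st c x h2.
have gst_ok s x := @gst_upd st s x h7.
have txn_ok T x : stable st (tx_sn x) -> forall T1 x1,
  upd (st_txn st) T (Some x) T1 = Some x1 ->
    stable st (tx_sn x1).
  by move=> xok T1 x1; rewrite updE; case: eqP => [_ [<-]|_ /h3].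
case: dl E netE le hm dq_ok out_ok.
- move=> st1 c s u T _ x E netE le hm dq_ok out_ok; subst st1.
  have xok : stable st (sv_ust x) by apply: stable_max; [apply: h1|apply: hm].
  apply: (snap_inv_step le) => /=; auto.
    exact: txn_ok.
  by apply/out_ok/to_ok => _ [<-].
- move=> st1 c s T sn _ E netE le hm dq_ok out_ok; subst st1.
  by apply: (snap_inv_step le) => /=; auto.
- move=> st1 c s T x ks pick txT E netE le hm dq_ok out_ok; subst st1.
  apply: (snap_inv_step le) => /=; auto.
  apply: out_ok => -[|s'] m0 u //= /mapP[key _ ->] [<-].
  exact: h3 txT.
- move=> st1 s s' T sn key o _ E netE le hm dq_ok out_ok; subst st1.
  apply: (snap_inv_step le) => /=; auto.
    by apply: ust_ok; apply: stable_max; [apply: h1|apply: hm].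
  by apply/out_ok/to_ok.
- move=> st1 s s' T x key o _ E netE le hm dq_ok out_ok; subst st1.
  apply: (snap_inv_step le) => /=; auto.
  by apply/out_ok/to_ok.
- move=> st1 c s T key o ks _ E netE le hm dq_ok out_ok; subst st1.
  apply: (snap_inv_step le) => /=; auto.
  by apply: cli_ok; apply: h2.
- move=> st1 c s T x hwt ws co txT x' E netE le hm dq_ok out_ok; subst st1.
  have xok : stable st (tx_sn x) by apply: h3 txT.
  apply: (snap_inv_step le) => /=; auto.
    exact: txn_ok.
  by apply: out_ok => q' m0 u /mem_prepare_messages[s1 _ [_ ->]] [<-].
- move=> st1 s s' T sn ht ups clk _ E netE le hm dq_ok out_ok; subst st1.
  apply: (snap_inv_step le) => /=; auto.
    by apply: ust_ok; apply: stable_max; [apply: h1|apply: hm].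
  by apply/out_ok/to_ok.
- move=> st1 s s' T x pt txT x' E netE le hm dq_ok out_ok; subst st1.
  have xok : stable st (tx_sn x) by apply: h3 txT.
  apply: (snap_inv_step le) => /=; auto.
    exact: txn_ok.
  apply: out_ok => y m0 u; rewrite /decision_messages; case: (tx_ct x') => // ct.
  by case: y => [c|s1]; case: ifP => // _; rewrite inE => /eqP->.
- move=> st1 s s' T ct clk _ E netE le hm dq_ok out_ok; subst st1.
  apply: (snap_inv_step le) => /=; auto.
  by apply: ust_ok; apply: h1.
- move=> st1 c s T ct _ E netE le hm dq_ok out_ok; subst st1.
  apply: (snap_inv_step le) => /=; auto.
  by apply: cli_ok; apply: h2.
- move=> st1 s s' ct ds E netE le hm dq_ok out_ok; subst st1.
  apply: (snap_inv_step le) => /=; auto.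
  by apply: ust_ok; apply: h1.
- move=> st1 s s' t E netE le hm dq_ok out_ok; subst st1.
  apply: (snap_inv_step le) => /=; auto.
  by apply: ust_ok; apply: h1.
Qed.

Lemma step_snap_inv st st' : snap_inv st -> vv_le st st' -> step st st' ->
  snap_inv st'.
Proof.
move=> inv le stp; case: stp le => [st1 int|p q m ms st1 netE dl] le.
  exact: internal_snap_inv int.
exact: deliver_snap_inv netE dl.
Qed.

Lemma snap_inv0 : snap_inv (state0 S).
Proof. by split. Qed.

(** * Installation at the replicas *)

Lemma mem_dequeue_or net p q m ms x y m0 : net p q = m :: ms -> m0 \in net x y ->
  m0 \in dequeue net p q x y \/ [/\ m0 = m, x = p & y = q].
Proof.
rewrite /dequeue => e; case: andP => [[/eqP-> /eqP->]|_]; last by left.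
by rewrite e inE => /orP[/eqP->|]; [right|left].
Qed.

Lemma deliver_net p q m st st' : deliver p q m st st' ->
  forall x y m0, m0 \in st_net st x y -> m0 \in st_net st' x y.
Proof. by case=> * //=; rewrite mem_send; apply/orP; left. Qed.

Lemma internal_net st st' : internal st st' ->
  forall x y m0, m0 \in st_net st x y -> m0 \in st_net st' x y.
Proof. by case=> * //=; rewrite mem_send; apply/orP; left. Qed.

Definition keeps (x x' : server_state S) : Prop :=
  {subset sv_prep x <= sv_prep x'} /\ {subset sv_comm x <= sv_comm x'}.

(* The only events at which a server forgets an entry are the receipt of a commit
   message and the application of updates. *)
Lemma step_keeps st st' s : step st st' ->
  [\/ keeps (st_srv st s) (st_srv st' s),
      exists p T ct ms clk, st_net st p (inS s) = MCommit S T ct :: ms /\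
        st_srv st' s = commit (st_srv st s) clk T ct
    | exists2 clk, sv_clock (st_srv st s) <= clk &
        st' = post (set_srv st s (apply_updates s (st_srv st s) clk))
          (inS s) (to_replicas s (apply_messages s (st_srv st s) clk))].
Proof.
have keep s1 x : keeps (st_srv st s1) x ->
    keeps (st_srv st s) (upd (st_srv st) s1 x s).
  by rewrite updE; case: (eqVneq s s1) => [->|_ _] //; split=> e.
case=> [st1 []|p q m ms st1 netE]; try by move=> *; apply: Or31; do ?apply: keep;
  split=> e.
  move=> s1 clk lec; case: (eqVneq s1 s) => [s1E|ne].
    by apply: Or33; rewrite -s1E; exists clk.
  by apply: Or31; rewrite /= updE eq_sym (negPf ne); split=> e.
move E: (set_net _ _) => st0 dl; case: dl E netE; try by move=> *; subst;
  apply: Or31; do ?apply: keep; split=> e.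
  move=> st2 s1 s2 T sn ht ups clk _ E netE; subst st2; apply: Or31; apply: keep.
  by split=> // e; rewrite inE => ->; rewrite orbT.
move=> st2 s1 s2 T ct clk _ E netE; subst st2; rewrite /= updE.
case: (eqVneq s s2) => [sE|_]; last by apply: Or31; split=> e.
by apply: Or32; exists (inS s1), T, ct, ms, clk; rewrite sE.
Qed.

Lemma step_store st st' s : step st st' ->
  {subset sv_store (st_srv st s) <= sv_store (st_srv st' s)}.
Proof.
have keep s1 x : {subset sv_store (st_srv st s1) <= sv_store x} ->
    {subset sv_store (st_srv st s) <= sv_store (upd (st_srv st) s1 x s)}.
  by rewrite updE; case: (eqVneq s s1) => [->|_ _ d].
have cat_incl (l l' : seq (version S)) : {subset l <= l ++ l'}.
  by move=> d; rewrite mem_cat => ->.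
case=> [st1 []|p q m ms st1 netE]; try by move=> *; do ?apply: keep; move=> d.
  by move=> *; apply: keep; apply: cat_incl.
move E: (set_net _ _) => st0 dl; case: dl E netE; try by move=> *; subst;
  do ?apply: keep; move=> d.
  by move=> *; subst; apply: keep; apply: cat_incl.
by move=> *; subst; apply: keep; apply: cat_incl.
Qed.

Lemma deliver_replicate p q ct ds st st' s :
  deliver p q (MReplicate ct ds) st st' ->
  q = inS s -> {subset ds <= sv_store (st_srv st' s)}.
Proof.
move E: (MReplicate ct ds) => m dl; case: dl E =>
  // st1 s1 s2 ct1 ds1 [_ ->] [<-] d dP.
by rewrite /= updE eqxx /= mem_cat dP orbT.
Qed.

Lemma step_replicate st st' s s' ct ds : step st st' ->
  MReplicate ct ds \in st_net st (inS s) (inS s') ->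
  MReplicate ct ds \in st_net st' (inS s) (inS s') \/
  {subset ds <= sv_store (st_srv st' s')}.
Proof.
case=> [st1 /internal_net keep /keep|p q m ms st1 netE dl mP]; first by left.
have [/(deliver_net dl)|[mE _ qE]] := mem_dequeue_or netE mP; first by left.
by right; rewrite -mE in dl; apply: (deliver_replicate dl (esym qE)).
Qed.

Lemma deliver_commit p q T ct st st' s e : deliver p q (MCommit S T ct) st st' ->
  q = inS s -> e \in sv_prep (st_srv st s) -> e_tid e = T ->
  Entry T ct (e_ups e) \in sv_comm (st_srv st' s).
Proof.
move E: (MCommit S T ct) => m dl; case: dl E =>
  // st1 s1 s2 T1 ct1 clk _ [-> ->] [<-] eP eT.
rewrite /= updE eqxx /= mem_cat; apply/orP; left.
by apply/mapP; exists e => //; rewrite mem_filter eT eqxx.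
Qed.

Lemma step_commit st st' p s T ct e : step st st' ->
  MCommit S T ct \in st_net st p (inS s) -> e \in sv_prep (st_srv st s) ->
    e_tid e = T ->
  MCommit S T ct \in st_net st' p (inS s) \/
  Entry T ct (e_ups e) \in sv_comm (st_srv st' s).
Proof.
case=> [st1 /internal_net keep /keep|p1 q m ms st1 netE dl mP eP eT];
  first by left.
have [/(deliver_net dl)|[mE _ qE]] := mem_dequeue_or netE mP; first by left.
by right; rewrite -mE in dl; apply: (deliver_commit dl (esym qE)).
Qed.

Definition versions_at (x : txn S) (T : tid) (ct : nat) (s : server) :
  seq (version S) :=
  make_versions (dc s) ct T (writes_at x s.1).

(** Decided but not yet applied by the cohort: its commit message is under way or has been received.
    In both cases [local_inv] keeps the own entry below [ct], in the first because the proposal is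
    at most [ct]. *)
Definition pending st (T : tid) (x : txn S) (ct : nat) (s : server) : Prop :=
  (exists e p, [/\ e \in sv_prep (st_srv st s), e_tid e = T &
                   MCommit S T ct \in st_net st p (inS s)]) \/
  Entry T ct (writes_at x s.1) \in sv_comm (st_srv st s).

(** The stages on the way from the cohort [s] to any replica [s'] of the partition; for [s' = s] the
    versions pass directly from [pending] to the store. *)
Definition arriving st (T : tid) (x : txn S) (ct : nat) (s s' : server) : Prop :=
  [\/ pending st T x ct s,
      {subset versions_at x T ct s <= sv_store (st_srv st s')} |
      exists2 ds, MReplicate ct ds \in st_net st (inS s) (inS s') &
                  {subset versions_at x T ct s <= ds}].

Definition place_inv st : Prop := forall T x ct s s',
  st_txn st T = Some x -> tx_ct x = Some ct -> is_cohort x s -> s'.1 = s.1 ->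
  arriving st T x ct s s'.

Lemma pending_gt crd st T x ct s : txn_inv crd st -> vv_inv st ->
  pending st T x ct s -> sv_vv (st_srv st s) s.2 < ct.
Proof.
move=> tinv [loc _] [[e [p [eP eT mP]]]|eP]; last exact: (vv_lt_comm (loc s) eP).
exact: leq_trans (vv_lt_prep (loc s) eP) (entry_le_ct tinv mP eP eT).
Qed.

Lemma group_versions s (x : server_state S) e : e \in sv_comm x ->
  {subset make_versions (dc s) (e_ts e) (e_tid e) (e_ups e) <= group s x (e_ts e)}.
Proof.
move=> eP d dP; apply/flattenP.
exists (make_versions (dc s) (e_ts e) (e_tid e) (e_ups e)) => //.
by apply/mapP; exists e; rewrite // mem_filter eqxx.
Qed.

Lemma step_comm crd st st' T x ct s s' : txn_inv crd st -> step st st' ->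
  s'.1 = s.1 -> Entry T ct (writes_at x s.1) \in sv_comm (st_srv st s) ->
  arriving st' T x ct s s'.
Proof.
move=> tinv stp ss' eP; have [[_ cm]|[p [T1 [ct1 [ms [clk [_ xE]]]]]]|[clk _ ->]]
  := step_keeps s stp.
- by apply: Or31; right; apply: cm.
- by apply: Or31; right; rewrite xE /= mem_cat eP orbT.
have vP := group_versions (s := s) eP.
have := group_times_mem (st_srv st s) (upper_bound (st_srv st s) clk) ct.
rewrite (map_f (@e_ts S) eP) andbT; case: leqP => [_ ctP|lt _]; last first.
  by apply: Or31; right; rewrite /= updE eqxx /= mem_filter lt.
case: (eqVneq s'.2 s.2) => [ss2|ne].
  apply: Or32 => d /vP dP; rewrite (server_eq ss' ss2) /= updE eqxx /= mem_cat.
  by apply/orP; right; apply/flattenP; exists (group s (st_srv st s) ct) => //;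
    apply: map_f.
apply: Or33; exists (group s (st_srv st s) ct) => //=.
rewrite mem_send eqxx /to_replicas /= ss' eqxx ne /=; apply/orP; right.
by rewrite /apply_messages; case: (sv_comm _) eP => // *;
  apply: (map_f (fun ct => MReplicate ct _)).
Qed.

Lemma step_pending crd st st' T x ct s s' : txn_inv crd st -> step st st' ->
  st_txn st T = Some x -> tx_ct x = Some ct -> s'.1 = s.1 ->
  pending st T x ct s -> arriving st' T x ct s s'.
Proof.
move=> tinv stp txT ctx ss' [[e [p [eP eT mP]]]|];
  last exact: (step_comm tinv stp).
have upsE : e_ups e = writes_at x s.1.
  have [y [ty _ uy]] := entry_txn tinv.2 eP.
  by move: ty; rewrite eT txT uy => -[->].
apply: Or31; have [mP'|eC] := step_commit stp mP eP eT; last by right;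
  rewrite -upsE.
have [[pr _]|[p1 [T1 [ct1 [ms [clk [netE xE]]]]]]|[clk _ stE]] :=
  step_keeps s stp.
- by left; exists e, p; split=> //; apply: pr.
(* The message consumed may be another commit message for [T]; [commit_txn] then forces the same
   commit time. *)
- case: (eqVneq T1 T) => [T1E|ne]; last first.
    by left; exists e, p; split=> //; rewrite xE /= mem_filter eP eT eq_sym ne.
  subst T1; have : MCommit S T ct1 \in restrict vote_kind (st_net st) p1 (inS s).
    by rewrite mem_filter netE mem_head.
  case/(commit_txn tinv.2) => y; rewrite txT => -[<-]; rewrite ctx => -[ctE].
  right; rewrite xE -ctE /= mem_cat -upsE; apply/orP; left.
  by apply/mapP; exists e; rewrite // mem_filter eT eqxx.
- by left; exists e, p; split=> //; rewrite stE /= updE eqxx.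
Qed.

(** Only the last vote decides. Its sender still has the entry by [prepared_entry], the other
    cohorts by [open_entry], and the commit messages leave in the same step. *)
Lemma step_decide crd st st' T x ct s : txn_inv crd st -> step st st' ->
  st_txn st' T = Some x -> tx_ct x = Some ct -> is_cohort x s ->
  st_txn st T = Some x \/ pending st' T x ct s.
Proof.
move=> tinv stp txT ctx co; case: stp txT => [st1 []|p q m ms st1 netE];
  try by left.
move E: (set_net _ _) => st0 dl; case: dl E netE; try by move=> *; subst; left.
- move=> st2 c s1 u T1 _ x1 E netE; subst st2; rewrite /= updE;
    case: eqP => [_ [xE]|_]; last by left.
  by rewrite -xE in ctx.
- move=> st2 c s1 T1 y hwt ws co1 ty x' E netE; subst st2; rewrite /= updE.
  case: eqP => [_ [xE]|_]; last by left.
  by rewrite -xE in ctx.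
- move=> st2 s1 s2 T1 y pt ty x' E netE; subst st2; rewrite /= updE.
  case: eqP => [TE [xE]|_]; last by left.
  subst T1 x; right; left.
  have h := restrict_head (k := vote_kind) netE isT.
  have mP : MPrepared S T pt \in restrict vote_kind (st_net st) (inS s2) (inS s1).
    by rewrite h mem_head.
  have [_ coy _ cty] := awaited_open tinv.2 (prepared_awaited tinv.2 mP) ty.
  have [e eP eT] : exists2 e, e \in sv_prep (st_srv st s) & e_tid e = T.
    case: (eqVneq s.1 s2.1) => [sE|ne].
      rewrite (is_cohort_inj (x := y) co coy sE).
      exact: (prepared_entry tinv.2 mP).
    apply: (open_entry tinv.2 ty co cty).
    move: ctx; rewrite /x' /= /decision; case: ifP => // /forallP /(_ s.1) ap _.
    by case/andP: (co) => px _; have := implyP ap px; rewrite updE (negPf ne).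
  have mC : MCommit S T ct \in decision_messages x' T (inS s).
    by rewrite /decision_messages ctx /inS co mem_head.
  by exists e, (inS s1); split=> //; rewrite mem_send eqxx mC orbT.
Qed.

Lemma step_place_inv crd st st' : txn_inv crd st -> place_inv st -> step st st' ->
  place_inv st'.
Proof.
move=> tinv pinv stp T x ct s s' txT ctx co ss'.
have [txT0|] := step_decide tinv stp txT ctx co; last exact: Or31.
have [pd|st_ok|[ds mP sub]] := pinv T x ct s s' txT0 ctx co ss'.
- exact: (step_pending tinv stp txT0 ctx).
- by apply: Or32 => d /st_ok; apply: step_store.
- have [mP'|inst] := step_replicate stp mP; first by apply: Or33; exists ds.
  by apply: Or32 => d /sub /inst.
Qed.

Lemma place_inv0 : place_inv (state0 S).
Proof. by []. Qed.

(** If the versions were pending or under way, [chan_ok] would put the entry of [s'] for the cohort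
    strictly below [ct]. *)
Lemma arriving_installed crd st T x ct s s' : txn_inv crd st -> vv_inv st ->
  arriving st T x ct s s' -> s'.1 = s.1 -> ct <= sv_vv (st_srv st s') s.2 ->
  {subset versions_at x T ct s <= sv_store (st_srv st s')}.
Proof.
move=> tinv vinv; case: (vinv) => _ [ord _] [pd|//|[ds mP _]] ss' le.
  have := leq_trans le (chan_ok_le (ord s s' (esym ss'))).
  by rewrite leqNgt (pending_gt tinv vinv pd).
have mP' : MReplicate ct ds \in restrict repl_kind (st_net st) (inS s) (inS s').
  by rewrite mem_filter.
have := chan_ok_replicate (ord s s' (esym ss')) mP'.
by rewrite ltnNge le.
Qed.

(** * Executions *)

Section Run.

(** [s0] provides an initial value for [crd], since a system may have no servers; in the theorem a
    cohort of the writing transaction takes this role. *)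
Context (run : nat -> state S) (hrun : execution run) (s0 : server).

Lemma run_inv t : [/\ exists crd, txn_inv crd (run t), vv_inv (run t),
  snap_inv (run t) & place_inv (run t)].
Proof.
elim: t => [|t [[crd tinv] vinv sinv pinv]].
  rewrite hrun.1; split; [|exact: vv_inv0|exact: snap_inv0|exact: place_inv0].
  by exists (fun=> s0); apply: txn_inv0.
case: (hrun.2 t) => [->|stp]; first by split=> //; exists crd.
have [vinv' le] := step_vv_inv tinv vinv stp.
split=> //; [exact: step_txn_inv tinv stp|exact: step_snap_inv stp|].
exact: step_place_inv tinv pinv stp.
Qed.

Lemma run_decided t t' T x ct : t <= t' -> st_txn (run t) T = Some x ->
  tx_ct x = Some ct -> st_txn (run t') T = Some x.
Proof.
move=> + txT ctx; elim: t' => [|t' IH]; first by rewrite leqn0 => /eqP<-.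
rewrite leq_eqVlt => /orP[/eqP<-//|/IH txT'].
case: (hrun.2 t') => [->//|stp].
have [[crd tinv] _ _ _] := run_inv t'.
exact: step_decided tinv stp txT' ctx.
Qed.

Lemma decided_unique t t' T x x' : st_txn (run t) T = Some x ->
  st_txn (run t') T = Some x' -> tx_ct x <> None -> tx_ct x' <> None -> x = x'.
Proof.
move=> txT txT'; case ctx: (tx_ct x) => [ct|//] _;
  case ctx': (tx_ct x') => [ct'|//] _.
case: (leqP t t') => [le|/ltnW le].
  by have := run_decided le txT ctx; rewrite txT' => -[].
by have := run_decided le txT' ctx'; rewrite txT => -[].
Qed.

Lemma run_txn t t' T x : t <= t' -> st_txn (run t) T = Some x ->
  exists x', [/\ st_txn (run t') T = Some x',
    tx_sn x' = tx_sn x & tx_client x' = tx_client x].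
Proof.
move=> + txT; elim: t' => [|t' IH]; first by rewrite leqn0 => /eqP<-; exists x.
rewrite leq_eqVlt => /orP[/eqP<-|/IH[y [ty sn cl]]]; first by exists x.
case: (hrun.2 t') => [->|stp]; first by exists y.
by have [z [tz sz cz]] := step_txn stp ty; exists z; rewrite sz cz.
Qed.

Lemma txn_client_sn t t' T x x' : st_txn (run t) T = Some x ->
  st_txn (run t') T = Some x' -> tx_sn x' = tx_sn x /\ tx_client x' = tx_client x.
Proof.
move=> txT txT'; case: (leqP t t') => [le|/ltnW le].
  by have [y []] := run_txn le txT; rewrite txT' => -[<-].
by have [y []] := run_txn le txT'; rewrite txT => -[<-].
Qed.

Lemma run_vv_le t t' : t <= t' -> vv_le (run t) (run t').
Proof.
elim: t' => [|t' IH]; first by rewrite leqn0 => /eqP<-.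
rewrite leq_eqVlt => /orP[/eqP<-//|/IH le] s i; apply: leq_trans (le s i) _.
case: (hrun.2 t') => [->//|stp].
have [[crd tinv] vinv _ _] := run_inv t'.
by have [_] := step_vv_inv tinv vinv stp.
Qed.

(** When [T] is decided it is pending at [s], so the own entry is below [ct], and by monotonicity it
    was so at every earlier time. By [run_decided], [t] cannot be later than the decision. *)
Lemma undecided_gt t t' T x ct s : st_txn (run t') T = Some x ->
  tx_ct x = Some ct ->
  is_cohort x s -> st_txn (run t) T <> Some x ->
    sv_vv (st_srv (run t) s) s.2 < ct.
Proof.
move=> + ctx co ntx; elim: t' => [|t' IH txT]; first by rewrite hrun.1.
case: (hrun.2 t') => [e|stp]; first by apply: IH; rewrite -e.
have [[crd tinv] _ _ _] := run_inv t'.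
have [/IH//|pd] := step_decide tinv stp txT ctx co.
have [[crd' tinv'] vinv' _ _] := run_inv t'.+1.
apply: leq_ltn_trans (pending_gt tinv' vinv' pd).
apply: run_vv_le; rewrite leqNgt; apply/negP => lt.
exact: ntx (run_decided (ltnW lt) txT ctx).
Qed.

End Run.

(** * Atomicity of the visible snapshots *)

Lemma writtenP T x d ct : tx_ct x = Some ct ->
  d \in written (S := S) T x ->
  exists s, [/\ is_cohort x s, s.1 = part (v_key d), d \in versions_at x T ct s,
                v_ut d = ct & v_tid d = T].
Proof.
move=> ctx; rewrite /written ctx mem_pmap => /mapP[[key v] kvP] /=.
case co: (tx_cohort x _) => [r|] //= [->] /=.
exists (part key, r); split=> //=.
  by rewrite /is_cohort /= co eqxx andbT; apply/hasP; exists (key, v) => /=.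
by apply/mapP; exists (key, v); rewrite // mem_filter eqxx.
Qed.

End Paris.

Theorem proposition4 (S : system) (run : nat -> state S)
    (hrun : execution run)
    (T' : tid) (t' : nat) (x' : txn S)
    (hT' : st_txn (run t') T' = Some x')
    (hcommit : tx_ct x' <> None)
    (T : tid) (t : nat) (x : txn S)
    (hT : st_txn (run t) T = Some x)
    (hother : T <> T')
    (ch : serving S)
    (hch : admissible run T ch) :
  (forall d, d \in written T' x' -> in_snapshot run T x ch d) \/
  (forall d, d \in written T' x' -> ~ in_snapshot run T x ch d).
Proof.
case ctE: (tx_ct x') (hcommit) => [ct|//] _.
case: (leqP ct (tx_sn x)) => [le|gt].
  left=> d dW; have [s [co sE dP utE _]] := writtenP ctE dW.
  left; rewrite utE; split=> //; rewrite /installed /= -sE.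
  have := hch s.1; case: (ch s.1) => r u /=.
  case txT: (st_txn (run u) T) => [y|//] _.
  have [[crd tinv] vinv sinv pinv] := run_inv hrun s u.
  (* The record of [T] may have changed by the serving time [u], but not its snapshot timestamp. *)
  have sn_stable : stable (run u) (tx_sn x).
    by have [<- _] := txn_client_sn hrun hT txT; apply: (txn_stable sinv txT).
  (* If [T'] were undecided at time [u], the own entry of its cohort would be below [ct], hence
     below [tx_sn x], against [sn_stable]. *)
  have tx'E : st_txn (run u) T' = Some x'.
    apply: NNPP => /(undecided_gt hrun s hT' ctE co); rewrite ltnNge.
    by rewrite (leq_trans le) // sn_stable.
  apply: (arriving_installed tinv vinv (pinv _ _ _ _ (s.1, r) tx'E ctE co erefl)) => //.
  exact: leq_trans le (sn_stable _ _).
have snapE d : d \in written T' x' -> in_snapshot run T x ch d ->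
    own_earlier run T (tx_client x) d.
  move=> /(writtenP ctE)[s [_ _ _ utE _]] [[]|[_ //]].
  by rewrite utE leqNgt gt.
case: (classic (exists2 d, d \in written T' x' & own_earlier run T (tx_client x) d)).
  (* One version from the client's own writes suffices: its id identifies [T1] with [T'], whose only
     decided record is [x'], so all versions of [T'] come from the same earlier commit. *)
  case=> d0 d0W [t1 [T1 [x1 [tx1 cl1 d0W1 nT]]]]; left=> d dW; right.
  have [s [_ _ _ _ tidE]] := writtenP ctE d0W.
  case ct1: (tx_ct x1) => [c1|]; last by rewrite /written ct1 in d0W1.
  have [_ [_ _ _ _ tidE1]] := writtenP ct1 d0W1.
  have [_ [_ _ _ utE _]] := writtenP ctE dW.
  rewrite utE; split=> //; exists t1, T', x'.
  move: tx1; rewrite -tidE1 tidE => tx1.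
  have x1E : x1 = x' by apply: (decided_unique hrun s tx1 hT'); rewrite ?ct1 ?ctE.
  by rewrite -x1E; split=> //; rewrite x1E.
by move=> no; right=> d dW /(snapE d dW) own; apply: no; exists d.
Qed.
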